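(* Let $T_1^*\in(0,\tfrac12]$, and suppose that Assumption 2 stated in the context holds for this $T_1^*$. For $\epsilon>0$ let $h_\epsilon^*$ be the optimal graphon for the microcanonical entropy with edge density $T_1^*$ and triangle density $T_2^*=T_1^{*3}-T_1^{*3}\epsilon$, i.e. the maximiser of $-I(h)$ over graphons $h$ with $T_1(h)=T_1^*$ and $T_2(h)=T_1^{*3}-T_1^{*3}\epsilon$. Then, up to relabelling by a measure-preserving bijection of $[0,1]$, as $\epsilon\downarrow0$, $$h_\epsilon^*=T_1^*+\epsilon^{1/3}g^*+o(\epsilon^{2/3})$$ (uniformly on $[0,1]^2$), where $$g^*(x,y)=\begin{cases}-T_1^*,&(x,y)\in[0,\tfrac12]^2,\\ T_1^*,&(x,y)\in[0,\tfrac12]\times(\tfrac12,1]\ \cup\ (\tfrac12,1]\times[0,\tfrac12],\\ -T_1^*,&(x,y)\in(\tfrac12,1]^2.\end{cases}$$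
   Context: A graphon is a measurable function $h:[0,1]^2\to[0,1]$ with $h(x,y)=h(y,x)$; graphons are identified if $h_1(x,y)=h_2(\sigma x,\sigma y)$ for a measure-preserving bijection $\sigma$ of $[0,1]$, and $\tilde W$ is the resulting quotient space. $T_1(h)=\int_{[0,1]^2}h(x_1,x_2)\,dx_1dx_2$ and $T_2(h)=\int_{[0,1]^3}h(x_1,x_2)h(x_2,x_3)h(x_3,x_1)\,dx_1dx_2dx_3$ are the edge and triangle densities. $I(u)=\tfrac12u\log u+\tfrac12(1-u)\log(1-u)$ for $u\in[0,1]$ (with $0\log0=0$) and $I(h)=\int_{[0,1]^2}I(h(x,y))\,dx\,dy$. Assumption 2. For fixed $T_1^*\in(0,1)$ and $\epsilon$ (of either sign) sufficiently small, the maximiser $h^*_\epsilon$ of $\sup\{-I(\tilde h):\tilde h\in\tilde W,\ T_1(\tilde h)=T_1^*,\ T_2(\tilde h)=T_1^{*3}+\epsilon\}$ has the form $h_\epsilon^*=T_1^*+g_{11}1_{I\times I}+g_{12}1_{(I\times J)\cup(J\times I)}+g_{22}1_{J\times J}$ for some $g_{11},g_{12},g_{22}\in[-T_1^*,1-T_1^*]$ and $I\subset[0,1]$, $J=[0,1]\setminus I$. *)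

(* Defs.v *)
From mathcomp Require Import all_boot all_order all_algebra.
From mathcomp Require Import all_classical all_reals all_analysis.

Set Implicit Arguments.
Unset Strict Implicit.
Unset Printing Implicit Defensive.

Import Order.TTheory GRing.Theory Num.Theory.
Import numFieldNormedType.Exports.

Local Open Scope classical_set_scope.
Local Open Scope ring_scope.

Section Graphons.
Context {R : realType}.

Local Notation leb := (@lebesgue_measure R).
Local Notation leb2 := (leb \x leb)%E.
Local Notation leb3 := ((leb \x leb) \x leb)%E.

Definition I01 : set R := `[0, 1]%classic.
Definition sq01 : set (R * R) := I01 `*` I01.
Definition cube01 : set (R * R * R) := sq01 `*` I01.

(* Graphons are total functions on R * R of which only the restriction to
   the unit square is meaningful. *)
Definition graphon (h : R * R -> R) : Prop :=
  [/\ measurable_fun sq01 h,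
      forall z, sq01 z -> 0 <= h z <= 1 &
      forall x y, I01 x -> I01 y -> h (x, y) = h (y, x)].

Definition edge_density (h : R * R -> R) : R := \int[leb2]_(z in sq01) h z.

Definition triangle_density (h : R * R -> R) : R :=
  \int[leb3]_(w in cube01)
    (h (w.1.1, w.1.2) * h (w.1.2, w.2) * h (w.2, w.1.1)).

(* The library sets [ln 0 = 0], so [0 log 0 = 0]. *)
Definition Ifun (u : R) : R :=
  2^-1 * u * ln u + 2^-1 * (1 - u) * ln (1 - u).

Definition Igraphon (h : R * R -> R) : R := \int[leb2]_(z in sq01) Ifun (h z).

Definition is_maximiser (t1 t2 : R) (h : R * R -> R) : Prop :=
  [/\ graphon h, edge_density h = t1, triangle_density h = t2 &
      forall h', graphon h' -> edge_density h' = t1 -> triangle_density h' = t2 ->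
        - Igraphon h' <= - Igraphon h].

(* Measure-preserving bijections of [0, 1].  Measurability is Borel
   measurability; by Lusin-Souslin the condition on images (measurability of
   the inverse) follows from the others, and is listed so that the inverse is
   visibly of the same kind. *)
Definition mp_bijection (s : R -> R) : Prop :=
  [/\ set_bij I01 I01 s,
      measurable_fun I01 s,
      forall A, measurable A -> A `<=` I01 -> measurable (s @` A) &
      forall A, measurable A -> A `<=` I01 -> leb (I01 `&` s @^-1` A) = leb A].

Definition relabel (s : R -> R) (h : R * R -> R) : R * R -> R :=
  fun z => h (s z.1, s z.2).

(* The densities and the entropy do not see null sets, so graphons are
   identified up to relabelling and almost-everywhere equality. *)
Definition graphon_equiv (h1 h2 : R * R -> R) : Prop :=
  exists2 s, mp_bijection s &
    {ae leb2, forall z, sq01 z -> h1 z = relabel s h2 z}.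

Definition bipodal (t1 g11 g12 g22 : R) (I : set R) : R * R -> R :=
  let J := I01 `\` I in
  fun z => t1 + g11 * \1_(I `*` I) z
              + g12 * \1_((I `*` J) `|` (J `*` I)) z
              + g22 * \1_(J `*` J) z.

Definition has_bipodal_form (t1 : R) (h : R * R -> R) : Prop :=
  exists g11 g12 g22 (I : set R),
    [/\ [/\ - t1 <= g11 <= 1 - t1, - t1 <= g12 <= 1 - t1 &
            - t1 <= g22 <= 1 - t1],
        measurable I, I `<=` I01 &
        graphon_equiv h (bipodal t1 g11 g12 g22 I)].

(* [0^'] is the punctured neighbourhood filter: eps ranges over small nonzero
   reals of either sign. *)
Definition assumption2 (t1 : R) : Prop :=
  \forall eps \near (0 : R)^',
    (exists h, is_maximiser t1 (t1 ^+ 3 + eps) h) /\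
    (forall h, is_maximiser t1 (t1 ^+ 3 + eps) h -> has_bipodal_form t1 h).

Definition gstar (t1 : R) : R * R -> R := fun z =>
  if (z.1 <= 2^-1) && (z.2 <= 2^-1) then - t1
  else if (2^-1 < z.1) && (2^-1 < z.2) then - t1
  else t1.

(* r eps = o(phi eps) as eps decreases to 0, uniformly on the unit square;
   maximisers being determined only up to null sets, the uniform norm is the
   essential one. *)
Definition unif_littleo (r : R -> R * R -> R) (phi : R -> R) : Prop :=
  forall delta : R, 0 < delta ->
    \forall eps \near (0 : R)^'+,
      {ae leb2, forall z, sq01 z -> `|r eps z| <= delta * `|phi eps|}.

End Graphons.

(* Main.v *)
(** With [d = t1 eps^{1/3}], the bipodal graphon taking the values [t1 - d] on the
    two diagonal blocks of size 1/2 and [t1 + d] off them is feasible, and for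
    small [eps] it is the only optimum among the bipodal graphons: the error
    term is exactly 0.

    Write [h = t1 + g].  Since [I] has positive fourth derivative, the cubic
    Hermite interpolant [A + C g + B g^2 - k g^3] of [I(t1 + g)] at the nodes
    [g = -d, d] lies below [I(t1 + g)] with equality only at the nodes, and [k >= 0]
    exactly because [t1 <= 1/2].  As [g] has mean zero, it remains to bound
    [B |g|_2^2 - k (integral of g^3)] from below by [B d^2].  In the orthonormal
    basis [1, f] of the two-valued functions, [g = - rho f(x) f(y) + eta (f(x) + f(y))];
    the triangle constraint reads [rho^3 = d^3 + 3 (t1 - rho) eta^2], so
    [rho >= d], and completing a square gives [integral of g^3 <= 10 rho eta^2],
    which is absorbed by the term [2 B eta^2] of [B |g|_2^2 = B (rho^2 + 2 eta^2)]
    once [rho] is small.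

    The relabelling comes from the quantile functions of a set of measure 1/2
    and of its complement.  They form a bijection up to null sets; the null
    sets, enlarged by a null set [cantor_set] into which [0, 1] embeds, are
    matched by a Borel Cantor-Bernstein argument. *)

Require Import Defs.
From mathcomp Require Import all_boot all_order all_algebra.
From mathcomp Require Import ring lra.
From mathcomp Require Import all_classical all_reals all_analysis.
From mathcomp Require Import measurable_realfun.

Import Order.TTheory GRing.Theory Num.Theory.
Import numFieldNormedType.Exports.

Local Open Scope classical_set_scope.
Local Open Scope ring_scope.

Set Implicit Arguments.
Unset Strict Implicit.
Unset Printing Implicit Defensive.

(** * The entropy function *)

Section Calculus.
Context {R : realType}.
Implicit Types (f : R -> R) (s x p g d u : R).

Lemma MVT_derive f df x : 0 < x ->
  (forall s, 0 <= s <= x -> is_derive s 1 f (df s)) ->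
  exists2 c, 0 < c < x & f x - f 0 = df c * x.
Proof.
move=> x0 fd.
have [||c cx ->] := @MVT R f df 0 x x0.
- by move=> y; rewrite in_itv/= => /andP[/ltW ? /ltW ?]; apply: fd; apply/andP.
- apply: derivable_within_continuous => y; rewrite in_itv/= => yx.
  exact: (@ex_derive _ _ _ _ _ _ _ (fd y yx)).
- by exists c; [move: cx; rewrite in_itv | rewrite subr0].
Qed.

Lemma derive_gt0_lt f df x : 0 < x ->
  (forall s, 0 <= s <= x -> is_derive s 1 f (df s)) ->
  (forall s, 0 < s < x -> 0 < df s) -> f 0 < f x.
Proof.
move=> x0 fd df0; have [c cx e] := @MVT_derive f df x x0 fd.
by rewrite -subr_gt0 e mulr_gt0// df0.
Qed.

Lemma derive_ge0_le f df x : 0 <= x ->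
  (forall s, 0 <= s <= x -> is_derive s 1 f (df s)) ->
  (forall s, 0 <= s <= x -> 0 <= df s) -> f 0 <= f x.
Proof.
rewrite le_eqVlt => /predU1P[<-//|x0] fd df0.
have [c /andP[c0 cx] e] := @MVT_derive f df x x0 fd.
by rewrite -subr_ge0 e mulr_ge0 ?df0 ?(ltW x0)// !ltW.
Qed.

Lemma is_derive_funD f h x df dh : is_derive x 1 f df -> is_derive x 1 h dh ->
  is_derive x 1 (fun s => f s + h s) (df + dh).
Proof. exact: is_deriveD. Qed.

Lemma is_derive_funB f h x df dh : is_derive x 1 f df -> is_derive x 1 h dh ->
  is_derive x 1 (fun s => f s - h s) (df - dh).
Proof. exact: is_deriveB. Qed.

Lemma is_derive_funM f h x df dh : is_derive x 1 f df -> is_derive x 1 h dh ->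
  is_derive x 1 (fun s => f s * h s) (f x * dh + h x * df).
Proof. exact: is_deriveM. Qed.

Lemma is_derive_funZ f x df k : is_derive x 1 f df ->
  is_derive x 1 (fun s => k * f s) (k * df).
Proof. exact: is_deriveZ. Qed.

Lemma is_derive_funid x : is_derive x 1 (fun s : R => s) 1.
Proof. exact: is_derive_id. Qed.

Lemma is_derive_funcst k x : is_derive x 1 (fun _ : R => k : R) 0.
Proof. exact: is_derive_cst. Qed.

Lemma is_derive_affine p g x : is_derive x 1 (fun s : R => p + s * g) g.
Proof.
apply: is_derive_eq (is_derive_funD (is_derive_funcst p x)
  (is_derive_funM (is_derive_funid x) (is_derive_funcst g x))) _.
by ring.
Qed.

Lemma affine_gt0 p g s : 0 < p -> 0 < p + g -> 0 <= s <= 1 -> 0 < p + s * g.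
Proof.
move=> p0 pg /andP[s0]; rewrite le_eqVlt => /predU1P[->|s1]; first by rewrite mul1r.
have -> : p + s * g = (1 - s) * p + s * (p + g) by ring.
by rewrite ltr_wpDr ?mulr_ge0 ?(ltW pg)// mulr_gt0// subr_gt0.
Qed.

Lemma is_derive_ln_affine p g x : 0 < p + x * g ->
  is_derive x 1 (fun s : R => ln (p + s * g)) (g / (p + x * g)).
Proof.
move=> h; have := @is_derive1_comp R (@ln R) (fun s => p + s * g) x _ _
  (is_derive1_ln h) (is_derive_affine p g x).
by rewrite mulrC.
Qed.

Lemma is_derive_xlnx_affine p g x : 0 < p + x * g ->
  is_derive x 1 (fun s : R => (p + s * g) * ln (p + s * g))
    (g * (ln (p + x * g) + 1)).
Proof.
move=> h; apply: is_derive_eq (is_derive_funM (is_derive_affine p g x)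
  (is_derive_ln_affine h)) _.
by field; rewrite gt_eqF.
Qed.

(** [loghalf p d] is the inverse hyperbolic tangent of [d / p]. The values [ln (p + d)] and
    [ln (p - d)] are [logmean p d] plus and minus [loghalf p d], and the interpolant is written in
    these two quantities. *)
Definition loghalf (p d : R) : R := (ln (p + d) - ln (p - d)) / 2.
Definition logmean (p d : R) : R := (ln (p + d) + ln (p - d)) / 2.

Lemma is_derive_loghalf p x : 0 < p + x -> 0 < p - x ->
  is_derive x 1 (loghalf p) (p / (p ^+ 2 - x ^+ 2)).
Proof.
move=> h1 h2.
have -> : loghalf p = (fun s => 2^-1 * (ln (p + s * 1) - ln (p + s * (-1)))).
  by apply/funext => s; rewrite /loghalf mulr1 mulrN1 mulrC.
apply: is_derive_eq (is_derive_funZ 2^-1 (is_derive_funB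
  (@is_derive_ln_affine p 1 x _) (@is_derive_ln_affine p (-1) x _))) _;
  rewrite ?mulr1 ?mulrN1//.
have -> : p ^+ 2 - x ^+ 2 = (p + x) * (p - x) by ring.
by field; rewrite !gt_eqF.
Qed.

Lemma loghalf_ge p d : 0 <= d < p -> d / p <= loghalf p d.
Proof.
move=> /andP[d0 dp]; have p0 := le_lt_trans d0 dp.
rewrite -subr_ge0.
pose f s := loghalf p s - p^-1 * s.
have -> : loghalf p d - d / p = f d by rewrite /f mulrC.
have <- : f 0 = 0 by rewrite /f /loghalf addr0 subr0 mulr0 subrr mul0r subr0.
apply: (@derive_ge0_le f (fun x => p / (p ^+ 2 - x ^+ 2) - p^-1 * 1)) => // s /andP[s0 sd].
  apply: is_derive_funB (is_derive_funZ _ (is_derive_funid _)).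
  by apply: is_derive_loghalf; lra.
have h : 0 < p ^+ 2 - s ^+ 2 by nra.
rewrite subr_ge0 mulr1 ler_pdivlMr// mulrBr expr2 mulrA mulVf ?gt_eqF// mul1r.
by rewrite lerBlDr lerDl mulr_ge0 ?invr_ge0 ?sqr_ge0// ltW.
Qed.

(** The difference vanishes at [d = 0] and its derivative collapses to the positive [df]. This
    inequality settles the endpoint [g = - p], the upper bounds on the entropy and on [Icube], and
    the monotonicity in [mul_loghalf_nincr]. *)
Lemma loghalf_lt p d : 0 < d < p -> loghalf p d < p * d / (p ^+ 2 - d ^+ 2).
Proof.
move=> /andP[d0 dp]; have p0 := lt_trans d0 dp.
pose f s := s * p / (p ^+ 2 - s ^+ 2) - loghalf p s.
rewrite -subr_gt0.
have -> : p * d / (p ^+ 2 - d ^+ 2) - loghalf p d = f d by rewrite /f (mulrC p).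
have <- : f 0 = 0 by rewrite /f /loghalf addr0 subr0 !mul0r subrr mul0r subr0.
pose df s := 2 * p * s ^+ 2 / (p ^+ 2 - s ^+ 2) ^+ 2.
apply: (@derive_gt0_lt f df) => // s /andP[s0 sd]; last first.
  have h : 0 < p ^+ 2 - s ^+ 2 by nra.
  by rewrite /df divr_gt0 ?exprn_gt0// !mulr_gt0// exprn_gt0.
have h : p ^+ 2 - s ^+ 2 != 0 by rewrite gt_eqF//; nra.
have hq : is_derive s 1 (fun x => p ^+ 2 - x ^+ 2) (- (2 * s)).
  apply: is_derive_eq (is_derive_funB (is_derive_funcst (p ^+ 2) s)
    (is_derive_funM (is_derive_funid s) (is_derive_funid s))) _.
  by rewrite /=; ring.
have hv := @is_deriveV _ (fun x => p ^+ 2 - x ^+ 2) _ _ _ h hq.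
apply: is_derive_eq (is_derive_funB (is_derive_funM
   (is_derive_funM (is_derive_funid s) (is_derive_funcst p s)) hv)
   (@is_derive_loghalf p s _ _)) _; try lra.
rewrite /df /=.
rewrite -[_ *: _]/(_ * _).
by field.
Qed.

(* The cubic Hermite interpolant of [u ln u] at [p - d] and [p + d], in the variable
   [g = u - p]. *)
Definition hcub (p d g : R) : R :=
  p * logmean p d + d * loghalf p d / 2 +
  (1 + logmean p d - 3 * (d - p * loghalf p d) / (2 * d)) * g +
  loghalf p d / (2 * d) * g ^+ 2 +
  (d - p * loghalf p d) / (2 * d ^+ 3) * g ^+ 3.

(* The interpolation error [K s] of [(p + s g) ln (p + s g)] at the nodes [g = -d, d]
   satisfies [K 0 = K' 0 = 0], and [K'' s] is the error of interpolating
   [g^2 / (p + s g)], which is an explicit positive rational function. *)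
Lemma hcub_remainder_gt0 p d g : 0 < d < p -> 0 < p + g -> g ^+ 2 != d ^+ 2 ->
  hcub p d g < (p + g) * ln (p + g).
Proof.
move=> /andP[d0 dp] pg gd; have p0 := lt_trans d0 dp.
(* Cubic Hermite basis for the nodes [d] and [- d], evaluated at [g]: [w1], [w2] carry the values
   and [w3], [w4] the slopes. The slope of [E c s] in [c] is [s * (L c s + 1)], and [K 1] is the
   remainder to be bounded. *)
pose w1 := (g + d) ^+ 2 * (2 * d - g) / (4 * d ^+ 3).
pose w2 := (g - d) ^+ 2 * (2 * d + g) / (4 * d ^+ 3).
pose w3 := (g + d) ^+ 2 * (g - d) / (4 * d ^+ 2).
pose w4 := (g - d) ^+ 2 * (g + d) / (4 * d ^+ 2).
pose E c s := (p + s * c) * ln (p + s * c).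
pose L c s := ln (p + s * c).
pose K s := E g s - (w1 * E d s + w2 * E (- d) s + w3 * (s * (L d s + 1))
  + w4 * (s * (L (- d) s + 1))).
pose K1 s := g * (L g s + 1) - (w1 * (d * (L d s + 1)) +
   w2 * (- d * (L (- d) s + 1)) +
   w3 * (s * (d / (p + s * d) + 0) + (L d s + 1) * 1) +
   w4 * (s * (- d / (p + s * - d) + 0) + (L (- d) s + 1) * 1)).
pose K2 s := p ^+ 2 * s ^+ 2 * (g ^+ 2 - d ^+ 2) ^+ 2 /
   ((p + s * g) * (p ^+ 2 - s ^+ 2 * d ^+ 2) ^+ 2).
have posg s : 0 <= s <= 1 -> 0 < p + s * g by exact: affine_gt0.
have posd s : 0 <= s <= 1 -> 0 < p + s * d by apply: affine_gt0; lra.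
have posN s : 0 <= s <= 1 -> 0 < p + s * - d by apply: affine_gt0; lra.
have dK s : 0 <= s <= 1 -> is_derive s 1 K (K1 s).
  move=> s01; have h1 := posg s s01; have h2 := posd s s01; have h3 := posN s s01.
  have dL c : 0 < p + s * c -> is_derive s 1 (fun x => L c x + 1) (c / (p + s * c) + 0).
    move=> h; exact: (is_derive_funD (is_derive_ln_affine h) (is_derive_funcst _ _)).
  apply: is_derive_funB; first exact: is_derive_xlnx_affine.
  apply: is_derive_funD; first apply: is_derive_funD; first apply: is_derive_funD.
  - exact: is_derive_funZ (is_derive_xlnx_affine h2).
  - exact: is_derive_funZ (is_derive_xlnx_affine h3).
  - exact: is_derive_funZ (is_derive_funM (is_derive_funid _) (dL _ h2)).
  - exact: is_derive_funZ (is_derive_funM (is_derive_funid _) (dL _ h3)).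
have dK1 s : 0 <= s <= 1 -> is_derive s 1 K1 (K2 s).
  move=> s01; have h1 := posg s s01; have h2 := posd s s01; have h3 := posN s s01.
  have dL c : 0 < p + s * c -> is_derive s 1 (fun x => L c x + 1) (c / (p + s * c) + 0).
    move=> h; exact: (is_derive_funD (is_derive_ln_affine h) (is_derive_funcst _ _)).
  have dQ c : 0 < p + s * c -> is_derive s 1 (fun x => c / (p + x * c) + 0)
     (c * (- (p + s * c) ^- 2 * c) + 0).
    move=> h; have h' : p + s * c != 0 by rewrite gt_eqF.
    apply: is_derive_funD (is_derive_funcst _ _); apply: is_derive_funZ.
    exact: (@is_deriveV _ (fun x => p + x * c) _ _ _ h' (is_derive_affine p c s)).
  apply: is_derive_eq (is_derive_funB (is_derive_funZ g (dL g h1)) (is_derive_funD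
     (is_derive_funD (is_derive_funD (is_derive_funZ w1 (is_derive_funZ d (dL d h2)))
       (is_derive_funZ w2 (is_derive_funZ (- d) (dL (- d) h3))))
       (is_derive_funZ w3 (is_derive_funD (is_derive_funM (is_derive_funid _) (dQ d h2))
          (is_derive_funM (dL d h2) (is_derive_funcst _ _)))))
       (is_derive_funZ w4 (is_derive_funD (is_derive_funM (is_derive_funid _) (dQ (- d) h3))
          (is_derive_funM (dL (- d) h3) (is_derive_funcst _ _)))))) _.
  rewrite /K2 /w1 /w2 /w3 /w4 /=.
  have -> : p ^+ 2 - s ^+ 2 * d ^+ 2 = (p + s * d) * (p + s * - d) by ring.
  field; rewrite ?gt_eqF//=; do ?split; nra.
(* Hermite interpolation reproduces constants and the identity; these two identities make [K] and
   [K1] vanish at 0. *)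
have wsum : w1 + w2 = 1 by rewrite /w1 /w2; field; rewrite gt_eqF.
have w3E : w3 + w4 = g - d * (w1 - w2).
  by rewrite /w1 /w2 /w3 /w4; field; rewrite gt_eqF.
have K0 : K 0 = 0.
  rewrite /K /E /L !mul0r !addr0 !mulr0 !addr0 -mulrDl wsum; ring.
have K10 : K1 0 = 0.
  rewrite /K1 /E /L !mul0r !addr0 !add0r.
  transitivity ((g - (d * (w1 - w2) + (w3 + w4))) * (ln p + 1)); first ring.
  by rewrite w3E; ring.
have K1E : K 1 = (p + g) * ln (p + g) - hcub p d g.
  rewrite /K /E /L !mul1r /hcub /w1 /w2 /w3 /w4 /logmean /loghalf.
  by field; rewrite gt_eqF.
rewrite -subr_gt0 -K1E -K0.
apply: (@derive_gt0_lt K K1) => // s /andP[s0 s1].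
rewrite -K10; apply: (@derive_gt0_lt K1 K2) => // x /andP[x0 xs].
  by apply: dK1; rewrite x0 (le_trans xs)// ltW.
have x01 : 0 <= x <= 1 by lra.
rewrite /K2 divr_gt0//.
  have gd2 : 0 < (g ^+ 2 - d ^+ 2) ^+ 2 by rewrite exprn_even_gt0//= subr_eq0.
  by rewrite mulr_gt0// mulr_gt0 ?exprn_gt0.
rewrite mulr_gt0 ?posg// exprn_gt0//.
have -> : p ^+ 2 - x ^+ 2 * d ^+ 2 = (p + x * d) * (p + x * - d) by ring.
by rewrite mulr_gt0 ?posd ?posN.
Qed.

Lemma hcub_node p d g : 0 < d < p -> g ^+ 2 = d ^+ 2 ->
  hcub p d g = (p + g) * ln (p + g).
Proof.
move=> /andP[d0 dp] /eqP; rewrite eqf_sqr => /orP[]/eqP ->;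
  rewrite /hcub /logmean /loghalf; field; by rewrite gt_eqF.
Qed.

(** The endpoint [p + g = 0] is out of reach of the derivative argument, [ln] being singular there.
    The target value is 0, and the interpolant factors with the sign given by [loghalf_lt]. *)
Lemma hcubN_lt0 p d : 0 < d < p -> hcub p d (- p) < 0.
Proof.
move=> dp; have := loghalf_lt dp; move: dp => /andP[d0 dp].
have h : 0 < p ^+ 2 - d ^+ 2 by nra.
rewrite ltr_pdivlMr// => H.
have -> : hcub p d (- p) = (p ^+ 2 - d ^+ 2) / (2 * d ^+ 3) *
   (loghalf p d * (p ^+ 2 - d ^+ 2) - p * d).
  by rewrite /hcub; field; rewrite gt_eqF.
rewrite pmulr_rlt0; first by rewrite subr_lt0.
by rewrite divr_gt0// mulr_gt0// exprn_gt0.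
Qed.

Lemma hcub_lt p d g : 0 < d < p -> 0 <= p + g -> g ^+ 2 != d ^+ 2 ->
  hcub p d g < (p + g) * ln (p + g).
Proof.
move=> dp; rewrite le_eqVlt => /predU1P[e _|? ?]; last exact: hcub_remainder_gt0.
have -> : g = - p by lra.
by rewrite subrr mul0r hcubN_lt0.
Qed.

Lemma hcub_le p d g : 0 < d < p -> 0 <= p + g ->
  hcub p d g <= (p + g) * ln (p + g).
Proof.
move=> dp pg; have [e|ne] := eqVneq (g ^+ 2) (d ^+ 2).
  by rewrite (hcub_node dp e).
by rewrite ltW// hcub_lt.
Qed.

(** The second derivative [1 / u] of [u ln u] is at least 1 on [(0, 1]]; the bound is Taylor's
    formula along the segment from [p] to [p + g], with [u = 0] treated apart. *)
Lemma xlnx_quadratic_lb p g : 0 < p <= 1 -> 0 <= p + g <= 1 ->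
  p * ln p + (ln p + 1) * g + g ^+ 2 / 2 <= (p + g) * ln (p + g).
Proof.
move=> /andP[p0 p1] /andP[]; rewrite le_eqVlt => /predU1P[e _|pg pg1].
  have -> : g = - p by lra.
  by rewrite subrr mul0r; nra.
pose K s := (p + s * g) * ln (p + s * g) - (p * ln p + s * ((ln p + 1) * g)
   + g ^+ 2 / 2 * (s * s)).
pose K1 s := g * (ln (p + s * g) + 1) - ((ln p + 1) * g + g ^+ 2 / 2 * (s * 1 + s * 1)).
pose K2 s := g ^+ 2 * (p + s * g)^-1 - g ^+ 2.
have posg s : 0 <= s <= 1 -> 0 < p + s * g by exact: affine_gt0.
have K0 : K 0 = 0 by rewrite /K !mul0r addr0; ring.
have K10 : K1 0 = 0 by rewrite /K1 !mul0r addr0; ring.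
have -> : p * ln p + (ln p + 1) * g + g ^+ 2 / 2 =
   (p + g) * ln (p + g) - K 1 by rewrite /K !mul1r mulr1; ring.
rewrite gerBl -K0; apply: (@derive_ge0_le K K1) => // s s01.
  have h := posg s s01.
  exact: (is_derive_funB (is_derive_xlnx_affine h) (is_derive_funD (is_derive_affine _ _ s)
    (is_derive_funZ (g ^+ 2 / 2) (is_derive_funM (is_derive_funid s) (is_derive_funid s))))).
have /andP[s0 s1] := s01.
rewrite -K10; apply: (@derive_ge0_le K1 K2) => // x /andP[x0 xs].
  have h : 0 < p + x * g by apply: posg; lra.
  apply: is_derive_eq (is_derive_funB (is_derive_funZ g (is_derive_funD
   (is_derive_ln_affine h) (is_derive_funcst _ _))) (is_derive_funD (is_derive_funcst _ _)
    (is_derive_funZ (g ^+ 2 / 2) (is_derive_funD (is_derive_funM (is_derive_funid _)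
      (is_derive_funcst _ _))  (is_derive_funM (is_derive_funid _)
      (is_derive_funcst _ _)))))) _.
  by rewrite /K2 /cst /=; field; rewrite gt_eqF.
have h : 0 < p + x * g by apply: posg; lra.
rewrite /K2 subr_ge0 ler_peMr ?sqr_ge0// -[leLHS]invr1 lef_pV2 ?posrE//.
nra.
Qed.

Lemma logmean_le p d : 0 <= d < p -> logmean p d <= ln p.
Proof.
move=> /andP[d0 dp]; rewrite /logmean -lnM ?posrE; [|lra|lra].
rewrite ler_pdivrMr// mulr_natr -lnXn; last lra.
by rewrite ler_ln ?posrE; nra.
Qed.

(** The sum splits into a [logmean] part, bounded by concavity of [ln], and a [loghalf] part,
    bounded by [loghalf_lt]. *)
Lemma xlnx_second_difference_le p d : 0 < d < p ->
  (p + d) * ln (p + d) + (p - d) * ln (p - d) - 2 * (p * ln p) <=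
  2 * p * d ^+ 2 / (p ^+ 2 - d ^+ 2).
Proof.
move=> dp; have h1 := loghalf_lt dp; move: dp => /andP[d0 dp].
have h2 : logmean p d <= ln p by apply: logmean_le; lra.
have -> : 2 * p * d ^+ 2 / (p ^+ 2 - d ^+ 2) = 2 * d * (p * d / (p ^+ 2 - d ^+ 2)) by ring.
have -> : (p + d) * ln (p + d) + (p - d) * ln (p - d) =
  2 * p * logmean p d + 2 * d * loghalf p d.
  by rewrite /logmean /loghalf; field.
nra.
Qed.

(** The derivative of [p * loghalf p d] in [p] is [loghalf p d - p * d / (p ^+ 2 - d ^+ 2)],
    negative by [loghalf_lt]; [f] is the negated function, shifted to start at [t]. *)
Lemma mul_loghalf_nincr t p d : 0 < d < t -> t <= p ->
  p * loghalf p d <= t * loghalf t d.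
Proof.
move=> /andP[d0 dt] tp.
pose f s := (- (t + s * 1)) * ((ln ((t + d) + s * 1) - ln ((t - d) + s * 1)) / 2).
pose df s := (- (t + s * 1)) * (2^-1 * (1 / ((t + d) + s * 1) - 1 / ((t - d) + s * 1)))
  + ((ln ((t + d) + s * 1) - ln ((t - d) + s * 1)) / 2) * - 1.
have E s : f s = - ((t + s) * loghalf (t + s) d).
  by rewrite /f /loghalf mulr1 mulNr (addrAC t d s) (addrAC t (- d) s).
suff : f 0 <= f (p - t) by rewrite !E addr0 lerN2 addrC subrK.
apply: (@derive_ge0_le f df) => [|s /andP[s0 st]|s /andP[s0 st]]; first lra.
  have h1 : 0 < t + d + s * 1 by lra.
  have h2 : 0 < t - d + s * 1 by lra.
  have e : f = (fun x => (- 1 * (t + x * 1)) *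
      (2^-1 * (ln (t + d + x * 1) - ln (t - d + x * 1)))).
    by apply/funext => y; rewrite /f; ring.
  rewrite e; apply: is_derive_eq (is_derive_funM (is_derive_funZ _ (is_derive_affine _ _ _))
    (is_derive_funZ _ (is_derive_funB (is_derive_ln_affine h1) (is_derive_ln_affine h2)))) _.
  by rewrite /df; ring.
have : loghalf (t + s) d < (t + s) * d / ((t + s) ^+ 2 - d ^+ 2).
  by apply: loghalf_lt; lra.
rewrite /loghalf.
have -> : df s = (t + s) * d / ((t + s) ^+ 2 - d ^+ 2) -
   (ln (t + s + d) - ln (t + s - d)) / 2.
  rewrite /df !mulr1 (addrAC t d s) (addrAC t (- d) s).
  have -> : (t + s) ^+ 2 - d ^+ 2 = (t + s - d) * (t + s + d) by ring.
  by field; rewrite !gt_eqF//; lra.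
by move=> /ltW; rewrite subr_ge0.
Qed.
End Calculus.

(** * The two-block optimisation problem *)

Section Optimum.
Context {R : realType}.
Implicit Types (t d g : R).

(** The term in [1 - u] is interpolated in the reflected variable [- g], which is harmless because
    the nodes [d] and [- d] are swapped by the reflection. *)
Definition Icub t d g : R := 2^-1 * hcub t d g + 2^-1 * hcub (1 - t) d (- g).

Lemma IfunE t g :
  Ifun (t + g) = 2^-1 * ((t + g) * ln (t + g)) +
                 2^-1 * ((1 - t + - g) * ln (1 - t + - g)).
Proof. by rewrite /Ifun opprD addrA !mulrA. Qed.

Lemma Icub_le t d g : 0 < d < t -> t <= 2^-1 -> 0 <= t + g <= 1 ->
  Icub t d g <= Ifun (t + g).
Proof.
move=> dt t2 g01; rewrite IfunE /Icub.
have h1 : hcub t d g <= _ := @hcub_le R t d g dt ltac:(lra).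
have h2 : hcub (1 - t) d (- g) <= _ :=
  @hcub_le R (1 - t) d (- g) ltac:(lra) ltac:(lra).
lra.
Qed.

Lemma Icub_lt t d g : 0 < d < t -> t <= 2^-1 -> 0 <= t + g <= 1 ->
  g ^+ 2 != d ^+ 2 -> Icub t d g < Ifun (t + g).
Proof.
move=> dt t2 g01 gd; rewrite IfunE /Icub.
have h1 : hcub t d g < _ := @hcub_lt R t d g dt ltac:(lra) gd.
have h2 : hcub (1 - t) d (- g) <= _ :=
  @hcub_le R (1 - t) d (- g) ltac:(lra) ltac:(lra).
lra.
Qed.

Lemma Icub_node t d g : 0 < d < t -> t <= 2^-1 -> g ^+ 2 = d ^+ 2 ->
  Icub t d g = Ifun (t + g).
Proof.
move=> dt t2 gd; rewrite IfunE /Icub (hcub_node dt gd) (@hcub_node _ (1 - t))//.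
  by lra.
by rewrite sqrrN.
Qed.

(** The coefficients [B] and [k] of the overview. In [bipodal_optimum] they are called [B] and [D],
    and [k] there is another quantity. *)
Definition Isq t d : R := (loghalf t d + loghalf (1 - t) d) / (4 * d).
Definition Icube t d : R :=
  (t * loghalf t d - (1 - t) * loghalf (1 - t) d) / (4 * d ^+ 3).

Lemma IcubE t d : exists A C, forall g,
  Icub t d g = A + C * g + Isq t d * g ^+ 2 - Icube t d * g ^+ 3.
Proof.
exists (2^-1 * (t * logmean t d + d * loghalf t d / 2 +
  ((1 - t) * logmean (1 - t) d + d * loghalf (1 - t) d / 2))).
exists (2^-1 * (1 + logmean t d - 3 * (d - t * loghalf t d) / (2 * d) -
  (1 + logmean (1 - t) d - 3 * (d - (1 - t) * loghalf (1 - t) d) / (2 * d)))).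
move=> g; rewrite /Icub /hcub /Isq /Icube.
have [->|d0] := eqVneq d 0; last by field.
by rewrite expr0n/= !(mulr0, invr0, mul0r); ring.
Qed.

Lemma Isq_gt t d : 0 < d < t -> t <= 2^-1 -> (4 * t)^-1 < Isq t d.
Proof.
move=> dt t2; have t0 : 0 < t by lra.
have d0 : 0 < d by lra.
have h1 : d / t <= loghalf t d by apply: loghalf_ge; lra.
have h2 : d / (1 - t) <= loghalf (1 - t) d by apply: loghalf_ge; lra.
have h3 : 0 < d / (1 - t) by rewrite divr_gt0//; lra.
rewrite /Isq ltr_pdivlMr ?mulr_gt0//.
have -> : (4 * t)^-1 * (4 * d) = d / t by field; rewrite gt_eqF.
lra.
Qed.

(** The sign comes from [t <= 1 - t] and the monotonicity of [p * loghalf p d] in [p]. *)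
Lemma Icube_ge0 t d : 0 < d < t -> t <= 2^-1 -> 0 <= Icube t d.
Proof.
move=> dt t2; have d0 : 0 < d by lra.
rewrite /Icube divr_ge0 ?mulr_ge0 ?exprn_ge0 ?(ltW d0)// subr_ge0.
by apply: mul_loghalf_nincr => //; lra.
Qed.

(** The numerator is at most [d ^+ 3 / (t ^+ 2 - d ^+ 2)], which [d <= t / 2] bounds by
    [4 * d ^+ 3 / (3 * t ^+ 2)]; the factor 4 cancels against the denominator of [Icube]. *)
Lemma Icube_le t d : 0 < d -> d <= t / 2 -> t <= 2^-1 ->
  Icube t d <= (3 * t ^+ 2)^-1.
Proof.
move=> d0 dt t2; have t0 : 0 < t by lra.
have h1 : loghalf t d < t * d / (t ^+ 2 - d ^+ 2) by apply: loghalf_lt; lra.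
have h2 : d / (1 - t) <= loghalf (1 - t) d by apply: loghalf_ge; lra.
have h0 : 0 < t ^+ 2 - d ^+ 2 by nra.
rewrite /Icube ler_pdivrMr ?mulr_gt0 ?exprn_gt0//.
have h3 : d <= (1 - t) * loghalf (1 - t) d.
  by rewrite mulrC -ler_pdivrMr//; lra.
have h4 : t * loghalf t d <= d + d ^+ 3 / (t ^+ 2 - d ^+ 2).
  have -> : d + d ^+ 3 / (t ^+ 2 - d ^+ 2) = t * (t * d / (t ^+ 2 - d ^+ 2)).
    by field; rewrite gt_eqF.
  by rewrite ler_pM2l// ltW.
have h5 : d ^+ 3 / (t ^+ 2 - d ^+ 2) <= (3 * t ^+ 2)^-1 * (4 * d ^+ 3).
  rewrite ler_pdivrMr//.
  have -> : (3 * t ^+ 2)^-1 * (4 * d ^+ 3) * (t ^+ 2 - d ^+ 2) =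
     d ^+ 3 + d ^+ 3 * ((t ^+ 2 - 4 * d ^+ 2) / (3 * t ^+ 2)).
    by field; rewrite gt_eqF.
  have q1 : 0 <= t ^+ 2 - 4 * d ^+ 2 by nra.
  have q2 : 0 <= 3 * t ^+ 2 by rewrite mulr_ge0 ?sqr_ge0.
  have q3 : 0 <= d ^+ 3 by rewrite exprn_ge0// ltW.
  by rewrite lerDl mulr_ge0 ?divr_ge0.
lra.
Qed.

(** Paired with [Ifun_second_difference_le], this gives the a priori bound on the mean square
    deviation of an optimum. *)
Lemma Ifun_quadratic_lb t g : 0 < t -> t <= 2^-1 -> 0 <= t + g <= 1 ->
  Ifun t + (ln t - ln (1 - t)) / 2 * g + g ^+ 2 / 2 <= Ifun (t + g).
Proof.
move=> t0 t2 g01; rewrite IfunE -[X in Ifun X]addr0 IfunE oppr0 !addr0.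
have h1 := @xlnx_quadratic_lb R t g ltac:(lra) g01.
have h2 := @xlnx_quadratic_lb R (1 - t) (- g) ltac:(lra) ltac:(lra).
lra.
Qed.

Lemma Ifun_second_difference_le t d : 0 < d -> d <= t / 2 -> t <= 2^-1 ->
  (Ifun (t + d) + Ifun (t - d)) / 2 <= Ifun t + 4 / 3 * d ^+ 2 / t.
Proof.
move=> d0 dt t2; have t0 : 0 < t by lra.
rewrite !IfunE -[X in Ifun X]addr0 IfunE oppr0 !addr0 opprK.
have h p : t <= p -> 2 * p * d ^+ 2 / (p ^+ 2 - d ^+ 2) <= 8 / 3 * d ^+ 2 / t.
  move=> tp; have h0 : 0 < p ^+ 2 - d ^+ 2 by nra.
  have -> : 2 * p * d ^+ 2 / (p ^+ 2 - d ^+ 2) = d ^+ 2 * (2 * p / (p ^+ 2 - d ^+ 2)).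
    by ring.
  have -> : 8 / 3 * d ^+ 2 / t = d ^+ 2 * (8 / (3 * t)).
    by field; rewrite gt_eqF.
  rewrite ler_pM2l ?exprn_gt0// ler_pdivrMr// mulrAC ler_pdivlMr; nra.
have h1 := le_trans (@xlnx_second_difference_le R t d ltac:(lra)) (h t (lexx _)).
have h2 := le_trans (@xlnx_second_difference_le R (1 - t) d ltac:(lra))
  (h (1 - t) ltac:(lra)).
lra.
Qed.

Section bipodal_average.
Variables (t d al a b c : R).
Let be := 1 - al.

(** The integral over the unit square of [F] applied to a two-block function, where [al] is the
    measure of the first block and [b] the off-diagonal value. *)
Definition bavg (F : R -> R) : R :=
  al ^+ 2 * F a + 2 * al * be * F b + be ^+ 2 * F c.

Lemma bavg_le (F G : R -> R) : 0 <= al <= 1 -> F a <= G a -> F b <= G b ->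
  F c <= G c -> bavg F <= bavg G.
Proof.
move=> al01 ha hb hc; rewrite /bavg /be.
by rewrite !lerD// ler_wpM2l ?mulr_ge0 ?sqr_ge0//; lra.
Qed.
End bipodal_average.

(* [x / sqrt gam] is the third moment of the function [f] and [S = eta^2]. *)
Lemma cube_bound (rho k gam x S : R) : 0 < rho -> 0 < gam -> S = k ^+ 2 * gam ->
  S <= rho ^+ 2 ->
  - (rho ^+ 3 * x ^+ 2 / gam) + 6 * rho ^+ 2 * k * x - 6 * rho * S + 2 * k * S * x
  <= 10 * rho * S.
Proof.
move=> r0 g0 SE Sr.
have S0 : 0 <= S by rewrite SE mulr_ge0 ?sqr_ge0 ?ltW.
rewrite -subr_ge0 -(pmulr_lge0 _ g0).
set y := k * gam.
have -> : (10 * rho * S - (- (rho ^+ 3 * x ^+ 2 / gam) + 6 * rho ^+ 2 * k * x -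
   6 * rho * S + 2 * k * S * x)) * gam =
  rho ^+ 3 * x ^+ 2 - (6 * rho ^+ 2 + 2 * S) * (y * x) + 16 * rho * y ^+ 2.
  by rewrite /y SE; field; rewrite gt_eqF.
(* By [S <= rho ^+ 2] the mixed coefficient is at most [8 * rho ^+ 2], which is the mixed
   coefficient of the square introduced next. Its last coefficient 16 is the 10 of the statement
   plus the 6 of the term [- 6 * rho * S]. *)
have : `|y * x| * (6 * rho ^+ 2 + 2 * S) <= `|y * x| * (8 * rho ^+ 2).
  by rewrite ler_wpM2l//; lra.
have := ler_norm (y * x).
have : 0 <= rho * (rho * `|x| - 4 * `|y|) ^+ 2.
  by rewrite mulr_ge0 ?sqr_ge0// ltW.
rewrite (normrM y x) => h1 h2 h3.
have h4 : (6 * rho ^+ 2 + 2 * S) * (y * x) <= (6 * rho ^+ 2 + 2 * S) * (`|y| * `|x|).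
  have q := sqr_ge0 rho; apply: ler_wpM2l; [lra | by []].
have hx : x ^+ 2 = `|x| ^+ 2 by rewrite real_normK// num_real.
have hy : y ^+ 2 = `|y| ^+ 2 by rewrite real_normK// num_real.
rewrite hx hy.
have e : rho * (rho * `|x| - 4 * `|y|) ^+ 2 = rho ^+ 3 * `|x| ^+ 2 -
   `|y| * `|x| * (8 * rho ^+ 2) + 16 * rho * `|y| ^+ 2 by ring.
lra.
Qed.

(** The smallness of [d] is tuned so that the a priori estimate yields [rho <= t / 10], enough to
    absorb the cubic term. Equality in the resulting chain then determines all four parameters. *)
Lemma bipodal_optimum t d al a b c :
  0 < t -> t <= 2^-1 -> 0 < d -> d ^+ 2 <= t ^+ 3 / 300 -> 0 <= al <= 1 ->
  0 <= t + a <= 1 -> 0 <= t + b <= 1 -> 0 <= t + c <= 1 ->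
  let be := 1 - al in
  bavg al a b c id = 0 ->
  al ^+ 3 * (t + a) ^+ 3 + 3 * al ^+ 2 * be * ((t + a) * (t + b) ^+ 2)
   + 3 * al * be ^+ 2 * ((t + b) ^+ 2 * (t + c)) + be ^+ 3 * (t + c) ^+ 3
   = t ^+ 3 - d ^+ 3 ->
  bavg al a b c (fun g => Ifun (t + g)) <= (Ifun (t + d) + Ifun (t - d)) / 2 ->
  [/\ al = 2^-1, a = - d, b = d & c = - d].
Proof.
move=> t0 t2 d0 dsmall al01 a01 b01 c01 be edge tri ent.
have dt : d <= t / 2 by nra.
have d30 : 0 < d ^+ 3 by rewrite exprn_gt0.
(* A block of full measure would make the graphon constant: the edge constraint gives it the value
   [t], contradicting the triangle deficit [d ^+ 3]. *)
have al0 : 0 < al.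
  rewrite lt0r; case/andP: al01 => -> _; rewrite andbT; apply/eqP => e.
  by move: edge tri; rewrite /bavg /be e => h1 h2; nra.
have be0 : 0 < be.
  rewrite subr_gt0 lt_def; case/andP: al01 => _ ->; rewrite andbT; apply/eqP => e.
  by move: edge tri; rewrite /bavg /be -e => h1 h2; nra.
(* [rho] and [S = eta^2] are the coefficients of [g] in the basis [1, f]; with
   [k = eta / sqrt gam] no square root of [gam] is needed. *)
pose k := (al * a + be * b) / be.
pose rho := b - k * (be - al).
pose gam := al * be.
pose S := k ^+ 2 * gam.
pose x := be - al.
have aln0 : al != 0 by rewrite gt_eqF.
have ben0 : be != 0 by rewrite gt_eqF.
have gam0 : 0 < gam by rewrite mulr_gt0.
have alE : al = 1 - be by rewrite /be; ring.
have aE : a = - rho * be / al + 2 * k * be.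
  by rewrite /rho /k alE; field; rewrite -alE aln0 ben0.
have bE : b = rho + k * (be - al) by rewrite /rho; ring.
have cE : c = - rho * al / be - 2 * k * al.
  apply: (mulfI (expf_neq0 2 ben0)); move: edge; rewrite /bavg -/be => edge.
  have -> : be ^+ 2 * c = - (al ^+ 2 * a + 2 * al * be * b) by lra.
  by rewrite /rho /k alE; field; rewrite ben0.
have S0 : 0 <= S by rewrite /S mulr_ge0 ?sqr_ge0// ltW.
have sqE : bavg al a b c (fun g => g ^+ 2) = rho ^+ 2 + 2 * S.
  by rewrite /bavg -/be aE bE cE /S /gam alE; field; rewrite -alE aln0 ben0.
have cubeE : bavg al a b c (fun g => g ^+ 3) =
  - (rho ^+ 3 * x ^+ 2 / gam) + 6 * rho ^+ 2 * k * x - 6 * rho * S + 2 * k * S * x.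
  by rewrite /bavg -/be aE bE cE /S /gam /x alE; field; rewrite -alE aln0 ben0.
have triE : rho ^+ 3 = d ^+ 3 + 3 * (t - rho) * S.
  move: tri; rewrite aE bE cE => tri.
  suff e : t ^+ 3 + 3 * t * S - rho ^+ 3 - 3 * rho * S = t ^+ 3 - d ^+ 3 by lra.
  by rewrite -tri /S /gam alE; field; rewrite -alE aln0 ben0.
(* The competitor bounds the mean entropy from above and strong convexity bounds it from below; the
   linear term drops out by the edge constraint. *)
have apriori : rho ^+ 2 + 2 * S <= 8 / 3 * d ^+ 2 / t.
  have h := le_trans ent (Ifun_second_difference_le d0 dt t2).
  pose F g := Ifun t + (ln t - ln (1 - t)) / 2 * g + g ^+ 2 / 2.
  have h1 : bavg al a b c F <= bavg al a b c (fun g => Ifun (t + g)).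
    by apply: bavg_le => //; apply: Ifun_quadratic_lb.
  have h2 : bavg al a b c F = Ifun t + (ln t - ln (1 - t)) / 2 * bavg al a b c id +
     bavg al a b c (fun g => g ^+ 2) / 2 by rewrite /F /bavg /=; field.
  by move: h1; rewrite h2 edge sqE; lra.
have d2t : 8 / 3 * d ^+ 2 / t <= (t / 10) ^+ 2.
  rewrite ler_pdivrMr//.
  have -> : (t / 10) ^+ 2 * t = t ^+ 3 / 100 by field.
  have : 0 < t ^+ 3 by rewrite exprn_gt0.
  lra.
have rhot : rho <= t / 10.
  have h : rho ^+ 2 <= (t / 10) ^+ 2 by lra.
  apply: le_trans (ler_norm _) _.
  by rewrite -(@ler_sqr _ `|rho|) ?nnegrE ?normr_ge0 ?real_normK ?num_real//; lra.
have rhod : d <= rho.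
  rewrite leNgt; apply/negP => h.
  have : 0 <= (t - rho) * S by rewrite mulr_ge0//; lra.
  have : rho ^+ 3 < d ^+ 3.
    have [r0|r0] := leP 0 rho; last by rewrite (lt_trans _ d30)// exprn_odd_lt0.
    by rewrite ltrXn2r// nnegrE ltW.
  lra.
(* Since [rho <= t / 10], the factor [3 * (t - rho)] in [triE] exceeds [rho]. *)
have Srho : S <= rho ^+ 2.
  have h : 3 * (t - rho) * S <= rho ^+ 3 by lra.
  have : rho * S <= rho * rho ^+ 2 by rewrite -exprS; nra.
  by rewrite ler_pM2l//; lra.
have dt' : 0 < d < t by lra.
have rho0 : 0 < rho by lra.
have cubeB : bavg al a b c (fun g => g ^+ 3) <= 10 * rho * S.
  by rewrite cubeE; apply: (@cube_bound rho k gam x S).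
have [A [C IE]] := IcubE t d.
have Bgt := Isq_gt dt' t2.
have Dge := Icube_ge0 dt' t2.
have Dle := Icube_le d0 dt t2.
set B := Isq t d in IE Bgt; set D := Icube t d in IE Dge Dle.
have lb : bavg al a b c (Icub t d) <= bavg al a b c (fun g => Ifun (t + g)).
  by apply: bavg_le => //; apply: Icub_le.
have lbE : bavg al a b c (Icub t d) =
   A + C * bavg al a b c id + B * bavg al a b c (fun g => g ^+ 2) -
   D * bavg al a b c (fun g => g ^+ 3).
  by rewrite /bavg !IE /=; ring.
have compE : (Ifun (t + d) + Ifun (t - d)) / 2 = A + B * d ^+ 2.
  by rewrite -!(Icub_node dt' t2) ?sqrrN// !IE; field.
(* Here [10 * D * rho] is at most [1 / (3 * t)], while [2 * B] exceeds [1 / (2 * t)]. *)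
have slope : 0 < 2 * B - 10 * D * rho.
  have h1 : D * rho <= (3 * t ^+ 2)^-1 * (t / 10).
    by rewrite ler_pM// ltW.
  have h2 : (3 * t ^+ 2)^-1 * (t / 10) = (30 * t)^-1.
    by field; rewrite gt_eqF.
  have h3 : (30 * t)^-1 = (4 * t)^-1 * (4 / 30) by field; rewrite gt_eqF.
  have h4 : 0 < (4 * t)^-1 by rewrite invr_gt0 mulr_gt0.
  lra.
have Dcube : D * bavg al a b c (fun g => g ^+ 3) <= D * (10 * rho * S).
  by rewrite ler_wpM2l.
have rd : 0 <= B * (rho ^+ 2 - d ^+ 2).
  rewrite mulr_ge0//; last by nra.
  by apply: ltW; apply: lt_trans Bgt; rewrite invr_gt0 mulr_gt0.
have Ss : 0 <= S * (2 * B - 10 * D * rho) by rewrite mulr_ge0// ltW.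
(* The entropy is at most [A + B * d ^+ 2] and at least the interpolant's average, which exceeds
   [A + B * d ^+ 2] by at least the nonnegative terms of [rd] and [Ss]. Hence every slack is 0. *)
have [S00 eqI] : S * (2 * B - 10 * D * rho) = 0 /\
    bavg al a b c (Icub t d) = bavg al a b c (fun g => Ifun (t + g)).
  by move: lb; rewrite lbE edge sqE => lb; split; lra.
have S0E : S = 0 by apply/eqP; move/eqP: S00; rewrite mulf_eq0 (gt_eqF slope) orbF.
have k0 : k = 0.
  by apply/eqP; move/eqP: S0E; rewrite /S mulf_eq0 (gt_eqF gam0) orbF expf_eq0.
have rhoE : rho = d.
  move: triE; rewrite S0E mulr0 addr0 => /eqP.
  by rewrite eqrXn2 ?(ltW rho0) ?(ltW d0)// => /eqP.
(* The first block has positive measure, so equality of the averages forces [a] to be an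
   interpolation node. *)
have a2 : a ^+ 2 = d ^+ 2.
  apply/eqP/negP => /negP a2; suff : bavg al a b c (Icub t d) <
    bavg al a b c (fun g => Ifun (t + g)) by rewrite eqI ltxx.
  have h1 := Icub_lt dt' t2 a01 a2.
  have h2 := Icub_le dt' t2 b01.
  have h3 := Icub_le dt' t2 c01.
  rewrite /bavg -/be ltr_leD//; last by rewrite ler_wpM2l ?sqr_ge0.
  rewrite ltr_leD//; first by rewrite ltr_pM2l// exprn_gt0.
  by rewrite ler_wpM2l// mulr_ge0 ?mulr_ge0// ltW.
(* With [k = 0] and [rho = d], [a] is [- d * be / al], so [a ^+ 2 = d ^+ 2] forces the positive
   ratio [be / al] to be 1. *)
have half : al = 2^-1.
  move: a2; rewrite aE k0 rhoE mulr0 mul0r addr0 expr_div_n => /eqP.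
  have -> : (- d * be) ^+ 2 / al ^+ 2 = d ^+ 2 * (be / al) ^+ 2.
    by field; rewrite aln0.
  have q : 0 < be / al by rewrite divr_gt0.
  rewrite -subr_eq0.
  have -> : d ^+ 2 * (be / al) ^+ 2 - d ^+ 2 =
      d ^+ 2 * ((be / al + 1) * (be / al - 1)) by ring.
  rewrite !mulf_eq0 ?orbb (gt_eqF d0) (gt_eqF (ltr_wpDr ler01 q))/= subr_eq0.
  by move=> /eqP/(canRL (divfK aln0)); rewrite mul1r /be; lra.
have beE : be = al by rewrite /be half; field.
split=> //.
- by rewrite aE k0 rhoE beE mulr0 mul0r addr0 mulNr mulNr mulfK.
- by rewrite bE k0 mul0r addr0.
- by rewrite cE k0 rhoE beE mulr0 mul0r subr0 mulNr mulNr mulfK.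
Qed.
End Optimum.

(** * Integrals of bipodal graphons *)

Section NullSections.
Context d1 d2 (T1 : measurableType d1) (T2 : measurableType d2) (R : realType).
Variable m1 : {measure set T1 -> \bar R}.
Variable m2 : {sigma_finite_measure set T2 -> \bar R}.

(** The product measure is the integral of the measures of the sections, and a nonnegative integral
    vanishes exactly when its integrand is 0 almost everywhere. *)
Lemma product_measure_eq0 (N : set (T1 * T2)) : measurable N ->
  (m1 \x m2)%E N = 0%E <-> {ae m1, forall x, m2 (xsection N x) = 0%E}.
Proof.
move=> mN; have mf := measurable_fun_xsection m2 mN.
have := ae_eq_integral_abs m1 measurableT mf.
rewrite /product_measure1; under eq_integral do rewrite gee0_abs//.
move=> ->; split=> H.
- by apply: filterS H => x /(_ I).
- by apply: filterS H => x /= -> _.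
Qed.
End NullSections.

Section AlmostEverywhere.
Context d (T : measurableType d) (R : realType) (mu : {measure set T -> \bar R}).
Implicit Types P Q : T -> Prop.

Lemma ae_imp P Q : (forall x, P x -> Q x) ->
  {ae mu, forall x, P x} -> {ae mu, forall x, Q x}.
Proof. by move=> PQ; apply: filterS. Qed.

Lemma ae_and P Q : {ae mu, forall x, P x} -> {ae mu, forall x, Q x} ->
  {ae mu, forall x, P x /\ Q x}.
Proof. by apply: filterS2. Qed.
End AlmostEverywhere.

Section SimpleIntegral.
Context d (T : measurableType d) (R : realType) (mu : {measure set T -> \bar R}).
Variables (D : set T).
Hypotheses (mD : measurable D) (Dfin : (mu D < +oo)%E).

Let simple (s : seq (R * set T)) (x : T) := \sum_(p <- s) p.1 * \1_(p.2) x.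

Lemma integrable_indicr (A : set T) : measurable A -> A `<=` D ->
  mu.-integrable D (EFin \o (\1_A : T -> R)).
Proof.
move=> mA AD; apply/integrableP; split.
  exact/measurable_EFinP/measurable_indic.
rewrite (eq_integral (EFin \o (\1_A : T -> R))); last first.
  by move=> x _ /=; rewrite ger0_norm// indicE ler0n.
rewrite integral_indic// (le_lt_trans _ Dfin)// le_measure ?inE//.
exact: measurableI.
Qed.

Lemma integrable_simple (s : seq (R * set T)) :
  (forall p, p \in s -> measurable p.2 /\ p.2 `<=` D) ->
  mu.-integrable D (EFin \o simple s) /\
  \int[mu]_(x in D) simple s x = \sum_(p <- s) p.1 * fine (mu p.2).
Proof.
elim: s => [_|p s IHs hs].
  have -> : simple [::] = cst 0 by apply/funext => x; rewrite /simple big_nil.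
  by split; [exact: integrable0 | rewrite big_nil Rintegral_cst// mul0r].
have [|IHs1 IHs2] := IHs; first by move=> q qs; apply: hs; rewrite inE qs orbT.
have [mp pD] := hs p (mem_head _ _).
have -> : simple (p :: s) = (fun x => p.1 * \1_(p.2) x + simple s x).
  by apply/funext => x; rewrite /simple big_cons.
have ip := integrable_indicr mp pD.
have ip' : mu.-integrable D (EFin \o (fun x => p.1 * \1_(p.2) x)).
  exact: (integrableZl mD p.1 ip).
split; first exact: (integrableD mD ip' IHs1).
rewrite RintegralD// IHs2 big_cons RintegralZl//; congr (_ * _ + _).
by rewrite /Rintegral integral_indic// setIidl.
Qed.

(** Turns an integral into a finite sum; it is applied with 4 cells of the square and with 8 cells
    of the cube. *)
Lemma Rintegral_ae_simple (f : T -> R) (s : seq (R * set T)) :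
  measurable_fun D f ->
  (forall p, p \in s -> measurable p.2 /\ p.2 `<=` D) ->
  {ae mu, forall x, D x -> f x = simple s x} ->
  \int[mu]_(x in D) f x = \sum_(p <- s) p.1 * fine (mu p.2).
Proof.
move=> mf hs fs; have [si <-] := integrable_simple hs.
rewrite /Rintegral; congr fine; apply: ae_eq_integral => //.
- exact/measurable_EFinP.
- exact: measurable_int si.
- by apply: filterS fs => x h Dx; rewrite h.
Qed.
End SimpleIntegral.

(** * Densities and entropy of a bipodal graphon as polynomials in the block size *)

Section GraphonIntegrals.
Context {R : realType}.
Local Notation leb := (@lebesgue_measure R).
Local Notation leb2 := (leb \x leb)%E.
Local Notation leb3 := ((leb \x leb) \x leb)%E.

Lemma measurable_I01 : measurable (@I01 R).
Proof. exact: measurable_itv. Qed.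

Lemma measurable_sq01 : measurable (@sq01 R).
Proof. by apply: measurableX; exact: measurable_I01. Qed.

Lemma measurable_cube01 : measurable (@cube01 R).
Proof. by apply: measurableX; [exact: measurable_sq01|exact: measurable_I01]. Qed.

Lemma leb_I01 : leb (@I01 R) = 1%E.
Proof. by rewrite lebesgue_measure_itv/= lte01 sube0. Qed.

Lemma leb2E (A B : set R) : measurable A -> measurable B ->
  leb2 (A `*` B) = (leb A * leb B)%E.
Proof. move=> mA mB; exact: (@product_measure1E _ _ _ _ _ leb leb A B mA mB). Qed.

Lemma leb3X (N : set (R * R)) (C : set R) : measurable N -> measurable C ->
  leb3 (N `*` C) = (leb2 N * leb C)%E.
Proof. by move=> mN mC; apply: product_measure1E. Qed.

Lemma leb3E (A B C : set R) : measurable A -> measurable B -> measurable C ->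
  leb3 (A `*` B `*` C) = (leb A * leb B * leb C)%E.
Proof. by move=> mA mB mC; rewrite leb3X ?leb2E//; exact: measurableX. Qed.

Lemma leb2_sq01_fin : (leb2 sq01 < +oo)%E.
Proof. by rewrite leb2E ?leb_I01 ?mule1 ?ltry//; exact: measurable_I01. Qed.

Lemma leb3_cube01_fin : (leb3 cube01 < +oo)%E.
Proof. by rewrite leb3E ?leb_I01 ?mule1 ?ltry//; exact: measurable_I01. Qed.

Lemma ae3_12 (P : R * R -> Prop) : {ae leb2, forall z, P z} ->
  {ae leb3, forall w : R * R * R, P w.1}.
Proof.
move=> [N [mN N0 PN]]; exists (N `*` setT); split.
- exact: measurableX.
- by rewrite leb3X// N0 mul0e.
- by move=> w /= Pw; split=> //; exact: PN.
Qed.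

(** Almost every section of the exceptional set is null, and [p] pulls the remaining null set of
    first coordinates back to a null set. The cases [p = snd] and [p = fst] serve the other two
    edges of a triangle. *)
Lemma ae3_pair (p : R * R -> R) (P : R * R -> Prop) :
  measurable_fun setT p ->
  (forall Z, measurable Z -> leb Z = 0%E -> leb2 (p @^-1` Z) = 0%E) ->
  {ae leb2, forall z, P z} ->
  {ae leb3, forall w : R * R * R, P (p w.1, w.2)}.
Proof.
move=> mp p0 [N [mN N0 PN]].
pose q (w : R * R * R) := (p w.1, w.2).
have mq : measurable_fun setT q.
  by apply/measurable_fun_pair => //; exact: measurableT_comp.
have mqN : measurable (q @^-1` N) by rewrite -[X in measurable X]setTI; exact: mq.
exists (q @^-1` N); split => //; last by move=> w /= Pw; exact: PN.
apply/(@product_measure_eq0 _ _ _ _ R leb2 leb) => //.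
move: (N0) => /(product_measure_eq0 leb leb mN)[Z [mZ Z0 NZ]].
exists (p @^-1` Z); split.
- by rewrite -[X in measurable X]setTI; exact: mp.
- exact: p0.
- move=> z /= h; apply: NZ => /= e; by apply: h; rewrite -e.
Qed.

Lemma ae3_23 (P : R * R -> Prop) : {ae leb2, forall z, P z} ->
  {ae leb3, forall w : R * R * R, P (w.1.2, w.2)}.
Proof.
apply: (@ae3_pair snd) => // Z mZ Z0.
have -> : (@snd R R) @^-1` Z = [set: R] `*` Z by apply/seteqP; split=> -[x y] //= [].
by rewrite leb2E// Z0 mule0.
Qed.

Lemma ae3_13 (P : R * R -> Prop) : {ae leb2, forall z, P z} ->
  {ae leb3, forall w : R * R * R, P (w.1.1, w.2)}.
Proof.
apply: (@ae3_pair fst) => // Z mZ Z0.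
have -> : (@fst R R) @^-1` Z = Z `*` [set: R] by apply/seteqP; split=> -[x y] //= [].
by rewrite leb2E// Z0 mul0e.
Qed.

Lemma measurable_Ifun : measurable_fun setT (@Ifun R).
Proof.
have m1 : measurable_fun setT (fun u : R => 1 - u).
  exact: measurable_funB.
apply: measurable_funD; apply: measurable_funM.
- exact: measurable_funM.
- exact: measurable_ln.
- exact: measurable_funM.
- exact: measurableT_comp (@measurable_ln R) m1.
Qed.

Lemma bipodal_sum (F : R -> R) (t a b c : R) (I : set R) z : sq01 z ->
  F (bipodal t a b c I z) = \sum_(p <- [:: (F (t + a), I `*` I);
    (F (t + b), I `*` (I01 `\` I)); (F (t + b), (I01 `\` I) `*` I);
    (F (t + c), (I01 `\` I) `*` (I01 `\` I))]) p.1 * \1_(p.2) z.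
Proof.
case: z => x y [/= x01 y01].
have E (A B : set R) : \1_(A `*` B) (x, y) = \1_A x * \1_B y :> R.
  by rewrite !indicE in_setX/= -natrM mulnb.
have Dx : \1_(I01 `\` I) x = 1 - \1_I x :> R.
  rewrite !indicE in_setD mem_set//=; case: (x \in I) => /=; ring.
have Dy : \1_(I01 `\` I) y = 1 - \1_I y :> R.
  rewrite !indicE in_setD mem_set//=; case: (y \in I) => /=; ring.
have U : \1_(I `*` (I01 `\` I) `|` (I01 `\` I) `*` I) (x, y) =
   \1_I x * (1 - \1_I y) + (1 - \1_I x) * \1_I y :> R.
  rewrite indicE in_setU !in_setX/= !in_setD !(mem_set x01) !(mem_set y01)/= !indicE.
  by case: (x \in I); case: (y \in I) => /=; ring.
rewrite /bipodal U !big_cons big_nil /= !E Dx Dy !indicE.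
by case: (x \in I); case: (y \in I);
  rewrite /= ?(mulr0, mulr1, subrr, subr0, addr0, mul0r, add0r, mul1r).
Qed.

Lemma bipodalE (t a b c : R) (I : set R) x y : I01 x -> I01 y ->
  bipodal t a b c I (x, y) = (t + a) * (\1_I x * \1_I y) +
    (t + b) * (\1_I x * (1 - \1_I y) + (1 - \1_I x) * \1_I y) +
    (t + c) * ((1 - \1_I x) * (1 - \1_I y)).
Proof.
move=> x1 y1; have := @bipodal_sum id t a b c I (x, y) (conj x1 y1).
rewrite /= => ->; rewrite !big_cons big_nil /= !indicE !in_setX/= !in_setD.
rewrite !(mem_set x1) !(mem_set y1)/=.
by case: (x \in I); case: (y \in I); rewrite /=; ring.
Qed.

Section BipodalIntegrals.
Variables (h : R * R -> R) (t a b c : R) (I : set R).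
Hypotheses (gh : graphon h) (mI : measurable I) (I1 : I `<=` I01).
Hypothesis hb : {ae leb2, forall z, sq01 z -> h z = bipodal t a b c I z}.
Let J := I01 `\` I.
Let al := fine (leb I).

Lemma fine_leb_sub01 (A : set R) : measurable A -> A `<=` I01 ->
  leb A = (fine (leb A))%:E /\ 0 <= fine (leb A) <= 1.
Proof.
move=> mA A1; have h1 : (leb A <= 1)%E.
  by rewrite -leb_I01 le_measure ?inE//; exact: measurable_I01.
have h2 : leb A \is a fin_num.
  by rewrite ge0_fin_numE// (le_lt_trans h1) ?ltry.
rewrite fineK//; split=> //.
by rewrite fine_ge0//= -lee_fin fineK.
Qed.

Let mJ : measurable J. Proof. by apply: measurableD => //; exact: measurable_I01. Qed.

Let lI : leb I = al%:E. Proof. by have [] := fine_leb_sub01 mI I1. Qed.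

Lemma leb_setD01 : leb J = (1 - al)%:E.
Proof.
have fin : (leb I01 < +oo)%E by rewrite leb_I01 ltry.
have -> : leb J = (leb I01 - leb (I01 `&` I))%E := measureD (mu := leb) measurable_I01 mI fin.
by rewrite setIidr// leb_I01 lI EFinB.
Qed.

Let mC (A B : set R) : measurable A -> A `<=` I01 -> measurable B -> B `<=` I01 ->
  measurable (A `*` B) /\ A `*` B `<=` sq01.
Proof.
move=> mA A1 mB B1; split; first exact: measurableX.
by move=> [x y] [/= /A1 ? /B1 ?].
Qed.

Let J1 : J `<=` I01. Proof. by move=> x []. Qed.

Lemma Rintegral_bipodal (F : R -> R) : measurable_fun setT F ->
  \int[leb2]_(z in sq01) F (h z) = bavg al a b c (fun g => F (t + g)).
Proof.
move=> mF; case: gh => mh _ _.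
etransitivity; first apply: (@Rintegral_ae_simple _ _ R leb2 sq01 measurable_sq01 _ _
  ([:: (F (t + a), I `*` I); (F (t + b), I `*` J); (F (t + b), J `*` I);
            (F (t + c), J `*` J)])); last first.
- rewrite !big_cons big_nil /=.
  suff E : F (t + a) * fine (leb2 (I `*` I)) + (F (t + b) * fine (leb2 (I `*` J)) +
      (F (t + b) * fine (leb2 (J `*` I)) + (F (t + c) * fine (leb2 (J `*` J)) + 0))) =
      bavg al a b c (fun g => F (t + g)) by exact: E.
  by rewrite !leb2E// lI leb_setD01 /= /bavg; ring.
- by apply: ae_imp hb => z hz zsq; rewrite hz// bipodal_sum.
- by move=> p; rewrite !inE => /orP[|/orP[|/orP[|]]] /eqP -> /=; apply: mC.
- exact: measurableT_comp.
- exact: leb2_sq01_fin.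
Qed.

Lemma edge_density_bipodal : edge_density h = bavg al a b c (fun g => t + g).
Proof. exact: (@Rintegral_bipodal id). Qed.

Lemma Igraphon_bipodal : Igraphon h = bavg al a b c (fun g => Ifun (t + g)).
Proof. exact: (Rintegral_bipodal measurable_Ifun). Qed.

Let A := t + a. Let B := t + b. Let C := t + c.

Lemma measurable_triangle : measurable_fun cube01
  (fun w : R * R * R => h (w.1.1, w.1.2) * h (w.1.2, w.2) * h (w.2, w.1.1)).
Proof.
case: gh => mh _ _.
have m11 : measurable_fun setT (fun w : R * R * R => w.1.1) by exact: measurableT_comp.
have m12 : measurable_fun setT (fun w : R * R * R => w.1.2) by exact: measurableT_comp.
have m2 : measurable_fun setT (fun w : R * R * R => w.2) by exact: measurable_snd.
have H (f g : R * R * R -> R) : measurable_fun setT f -> measurable_fun setT g ->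
   (forall w, cube01 w -> sq01 (f w, g w)) -> measurable_fun cube01 (fun w => h (f w, g w)).
  move=> mf mg fg; apply: (@measurable_comp _ _ _ _ _ _ sq01 h cube01 (fun w => (f w, g w))) => //.
  - exact: measurable_sq01.
  - by move=> _ [w ? <-]; exact: fg.
  - by apply: measurable_funTS; exact: measurable_fun_pair.
by apply: measurable_funM; first apply: measurable_funM; apply: H => // -[[x y] z] [[]].
Qed.

Lemma triangle_density_bipodal : triangle_density h =
  al ^+ 3 * A ^+ 3 + 3 * al ^+ 2 * (1 - al) * (A * B ^+ 2) +
  3 * al * (1 - al) ^+ 2 * (B ^+ 2 * C) + (1 - al) ^+ 3 * C ^+ 3.
Proof.
case: (gh) => mh _ hs.
have cell (X Y Z : set R) : measurable X -> X `<=` I01 -> measurable Y -> Y `<=` I01 ->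
    measurable Z -> Z `<=` I01 ->
    measurable (X `*` Y `*` Z) /\ X `*` Y `*` Z `<=` cube01.
  move=> mX X1 mY Y1 mZ Z1; split; first by apply: measurableX => //; exact: measurableX.
  by move=> [[x y] z] [[/= /X1 ? /Y1 ?] /Z1 ?].
etransitivity; first apply: (@Rintegral_ae_simple _ _ R leb3 cube01 measurable_cube01 _ _ ([::
    (A * A * A, I `*` I `*` I); (A * B * B, I `*` I `*` J);
    (B * B * A, I `*` J `*` I); (B * C * B, I `*` J `*` J);
    (B * A * B, J `*` I `*` I); (B * B * C, J `*` I `*` J);
    (C * B * B, J `*` J `*` I); (C * C * C, J `*` J `*` J)])); last first.
- rewrite !big_cons big_nil /=.
  suff E : A * A * A * fine (leb3 (I `*` I `*` I)) +
      (A * B * B * fine (leb3 (I `*` I `*` J)) +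
      (B * B * A * fine (leb3 (I `*` J `*` I)) +
      (B * C * B * fine (leb3 (I `*` J `*` J)) +
      (B * A * B * fine (leb3 (J `*` I `*` I)) +
      (B * B * C * fine (leb3 (J `*` I `*` J)) +
      (C * B * B * fine (leb3 (J `*` J `*` I)) +
      (C * C * C * fine (leb3 (J `*` J `*` J)) + 0))))))) =
      al ^+ 3 * A ^+ 3 + 3 * al ^+ 2 * (1 - al) * (A * B ^+ 2) +
      3 * al * (1 - al) ^+ 2 * (B ^+ 2 * C) + (1 - al) ^+ 3 * C ^+ 3 by exact: E.
  by rewrite !leb3E// lI leb_setD01 /=; ring.
- have h12 := ae3_12 hb; have h23 := ae3_23 hb; have h13 := ae3_13 hb.
  apply: ae_imp (ae_and h12 (ae_and h23 h13)) => -[[x y] z] /= [e12 [e23 e13]] [[/= x1 y1] z1].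
  (* Symmetry turns the third factor into [h (x, z)], the orientation covered by [ae3_13]. *)
  rewrite (hs z x)// e12// e23// e13//.
  rewrite !bipodalE//.
  rewrite !big_cons big_nil /= !indicE !in_setX/= !in_setD.
  rewrite !(mem_set x1) !(mem_set y1) !(mem_set z1)/=.
  by case: (x \in I); case: (y \in I); case: (z \in I); rewrite /A /B /C /=; ring.
- by move=> p; rewrite !inE =>
    /orP[|/orP[|/orP[|/orP[|/orP[|/orP[|/orP[|]]]]]]] /eqP -> /=; apply: cell.
- exact: measurable_triangle.
- exact: leb3_cube01_fin.
Qed.
End BipodalIntegrals.
End GraphonIntegrals.

(** * Measure-preserving bijections *)

Section NullEmbedding.
Context {R : realType}.
Local Notation leb := (@lebesgue_measure R).
Implicit Types (x y : R) (n m : nat).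

Definition ratn n : R := ratr (odflt 0 (unpickle n)).

Lemma ratn_between x y : x < y -> exists n, x <= ratn n < y.
Proof.
move=> /rat_in_itvoo[q]; rewrite in_itv/= => /andP[xq qy].
by exists (pickle q); rewrite /ratn pickleK/= qy (ltW xq).
Qed.

(* A strictly increasing function whose values have base 4 digits 0 and 1 only,
   hence with null range. *)
Definition cdigits x n : R := \sum_(k < n) 4^-1 ^+ k.+1 * (ratn k < x)%R%:R.

Lemma cdigitsS x n : cdigits x n.+1 = cdigits x n + 4^-1 ^+ n.+1 * (ratn n < x)%R%:R.
Proof. by rewrite /cdigits big_ord_recr. Qed.

Let q4 n : 0 < (4^-1 : R) ^+ n. Proof. by rewrite exprn_gt0. Qed.

Let bool01 (b : bool) : 0 <= (b%:R : R) <= 1.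
Proof. by case: b; rewrite /= ?lexx ler01. Qed.

Lemma cdigits_nd x n m : (n <= m)%N -> cdigits x n <= cdigits x m.
Proof.
elim: m => [|m IH]; first by rewrite leqn0 => /eqP ->.
rewrite leq_eqVlt => /predU1P[->//|]; rewrite ltnS => /IH h.
rewrite cdigitsS (le_trans h)// lerDl mulr_ge0 ?(ltW (q4 _))//.
Qed.

(** The next digit is at most 1 and [2 * 4^-1 <= 1], so the brackets from [cdigits x n] to
    [cdigits x n + 4^-1 ^+ n] are nested. *)
Lemma cdigits_upper x n m : (n <= m)%N ->
  cdigits x m + 4^-1 ^+ m <= cdigits x n + 4^-1 ^+ n.
Proof.
elim: m => [|m IH]; first by rewrite leqn0 => /eqP ->.
rewrite leq_eqVlt => /predU1P[->//|]; rewrite ltnS => /IH h.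
apply: le_trans h; rewrite cdigitsS.
have := bool01 (ratn m < x); have := q4 m; rewrite exprS; set b := (ratn m < x)%R%:R.
move=> h1 /andP[h2 h3]; have : 4^-1 ^+ m * b <= 4^-1 ^+ m by rewrite ler_piMr// ltW.
lra.
Qed.

Definition cantor x : R := sup (range (cdigits x)).

Let cdigits_le x n m : cdigits x n <= cdigits x m + 4^-1 ^+ m.
Proof.
have [nm|mn] := leqP n m.
  by rewrite (le_trans (cdigits_nd x nm))// lerDl ltW.
by rewrite (le_trans _ (cdigits_upper x (ltnW mn)))// lerDl ltW.
Qed.

Lemma cantor_bounds x n : cdigits x n <= cantor x <= cdigits x n + 4^-1 ^+ n.
Proof.
apply/andP; split.
  apply: ub_le_sup; last by exists n.
  by exists (cdigits x 0 + 4^-1 ^+ 0) => _ [m _ <-]; exact: cdigits_le.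
apply: ge_sup; first by exists (cdigits x 0), 0%N.
by move=> _ [m _ <-]; exact: cdigits_le.
Qed.

Lemma cantor01 x : I01 (cantor x).
Proof.
by have := cantor_bounds x 0; rewrite /cdigits big_ord0 add0r expr0 /I01/= in_itv.
Qed.

Let digit_le x y n : x <= y -> (ratn n < x)%R%:R <= (ratn n < y)%R%:R :> R.
Proof.
by move=> xy; case: (ltP (ratn n) x) => [/lt_le_trans ->//|_]; case: (_ < _).
Qed.

Lemma cdigits_le_mono x y n : x <= y -> cdigits x n <= cdigits y n.
Proof.
by move=> xy; apply: ler_sum => k _; rewrite ler_wpM2l ?(ltW (q4 _)) ?digit_le.
Qed.

Lemma cantor_nd x y : x <= y -> cantor x <= cantor y.
Proof.
move=> xy; apply: ge_sup; first by exists (cdigits x 0), 0%N.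
move=> _ [m _ <-]; apply: le_trans (cdigits_le_mono m xy) _.
by have /andP[] := cantor_bounds y m.
Qed.

(** The [n]-th digits are 0 for [x] and 1 for [y], and no other digit of [y] is below that of [x],
    so the gap opened at [n] persists. *)
Lemma cdigits_gap x y n m : x <= y -> ratn n < y -> x <= ratn n -> (n < m)%N ->
  cdigits x m + 4^-1 ^+ n.+1 <= cdigits y m.
Proof.
move=> xy ny xn; elim: m => // m IH; rewrite ltnS leq_eqVlt => /predU1P[e|nm].
  rewrite !cdigitsS -e ny ltNge xn /= mulr0 mulr1 addr0.
  by rewrite lerD2r cdigits_le_mono.
rewrite !cdigitsS addrAC lerD ?IH// ler_wpM2l ?(ltW (q4 _))//.
exact: digit_le.
Qed.

Lemma cantor_mono x y : x < y -> cantor x < cantor y.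
Proof.
move=> xy; have [n /andP[xn ny]] := ratn_between xy.
suff : cantor x + 4^-1 ^+ n.+1 <= cantor y.
  by apply: lt_le_trans; rewrite ltrDl.
rewrite -lerBrDr; apply: ge_sup; first by exists (cdigits x 0), 0%N.
move=> _ [m _ <-]; rewrite lerBrDr.
have h := cdigits_gap (ltW xy) ny xn (leq_maxl n.+1 m).
apply: le_trans (le_trans h _); last by have /andP[] := cantor_bounds y (maxn n.+1 m).
by rewrite lerD2r cdigits_nd// leq_maxr.
Qed.

(** A generalised inverse: being monotone on the whole line it is Borel, and it still inverts
    [cantor] on [I01]. *)
Definition cantorV z : R := sup [set x | I01 x /\ cantor x <= z].

Let cantorV_ub z : has_ubound [set x | I01 x /\ cantor x <= z].
Proof. by exists 1 => x [/=]; rewrite /I01/= in_itv/= => /andP[]. Qed.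

Lemma cantorK x : I01 x -> cantorV (cantor x) = x.
Proof.
move=> x01; apply/eqP; rewrite eq_le; apply/andP; split.
  apply: ge_sup; first by exists x.
  by move=> y [_]; rewrite leNgt => h; rewrite leNgt; apply: contra h => /cantor_mono.
by apply: ub_le_sup => //; split.
Qed.

Lemma cantorV_nd z w : z <= w -> cantorV z <= cantorV w.
Proof.
move=> zw; have [e|ne] := eqVneq [set x | I01 x /\ cantor x <= z] set0.
  (* The supremum of the empty set is 0 by convention, which is below every point of [I01]. *)
  rewrite {1}/cantorV e sup0 /cantorV.
  have [e'|/set0P[x [x01 cx]]] := eqVneq [set x | I01 x /\ cantor x <= w] set0.
    by rewrite e' sup0.
  apply: (@le_trans _ _ x); last by apply: ub_le_sup.
  by move: x01; rewrite /I01/= in_itv/= => /andP[].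
apply: ge_sup; first exact/set0P.
by move=> x [x01 xz]; apply: ub_le_sup => //; split=> //; exact: le_trans zw.
Qed.

Lemma measurable_cantor : measurable_fun setT cantor.
Proof. by apply: nondecreasing_measurable => // x y; exact: cantor_nd. Qed.

Lemma measurable_cantorV : measurable_fun setT cantorV.
Proof. by apply: nondecreasing_measurable => // x y; exact: cantorV_nd. Qed.

(** The image of [I01] under [cantor], written as a fixed-point condition so that its measurability
    is immediate. *)
Definition cantor_set : set R := [set z | I01 (cantorV z) /\ cantor (cantorV z) = z].

Lemma cantor_in x : I01 x -> cantor_set (cantor x).
Proof. by move=> x01; rewrite /cantor_set/= cantorK. Qed.

Lemma measurable_cantor_set : measurable cantor_set.
Proof.
have -> : cantor_set = cantorV @^-1` I01 `&`
    (fun z => cantor (cantorV z) - z) @^-1` [set 0].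
  apply/seteqP; split=> z [h1 h2]; split=> //=; first by rewrite h2 subrr.
  exact: subr0_eq.
apply: measurableI.
  by rewrite -[X in measurable X]setTI; apply: measurable_cantorV => //; exact: measurable_I01.
rewrite -[X in measurable X]setTI; apply: measurable_funB => //.
exact: measurableT_comp measurable_cantor measurable_cantorV.
Qed.

(** The possible values of the first [n] digits, that is, the left ends of the intervals of length
    [4^-1 ^+ n] covering [cantor_set]. *)
Fixpoint cantor_ends n : seq R :=
  if n is m.+1 then cantor_ends m ++ [seq v + 4^-1 ^+ m.+1 | v <- cantor_ends m]
  else [:: 0].

Lemma size_cantor_ends n : size (cantor_ends n) = (2 ^ n)%N.
Proof.
by elim: n => //= n IH; rewrite size_cat size_map IH expnS mul2n addnn.
Qed.

Lemma cdigits_ends x n : cdigits x n \in cantor_ends n.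
Proof.
elim: n => [|n IH]; first by rewrite /cdigits big_ord0 inE.
rewrite cdigitsS mem_cat; case: (_ < _); last by rewrite mulr0 addr0 IH.
rewrite mulr1; apply/orP; right; exact: (map_f (fun v => v + 4^-1 ^+ n.+1) IH).
Qed.

Lemma leb_bigU_itv (s : seq R) (e : R) : 0 <= e ->
  measurable (\big[setU/set0]_(v <- s) `[v, v + e]%classic) /\
  (leb (\big[setU/set0]_(v <- s) `[v, (v + e)%R]%classic) <= ((size s)%:R * e)%:E)%E.
Proof.
move=> e0; elim: s => [|v s [mU IH]]; first by rewrite big_nil measure0 mul0r.
rewrite big_cons; split; first by apply: measurableU => //; exact: measurable_itv.
apply: (@le_trans _ _ (leb `[v, (v + e)%R]%classic +
    leb (\big[setU/set0]_(v <- s) `[v, (v + e)%R]%classic))%E).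
  by apply: measureU2 => //; exact: measurable_itv.
rewrite [size (v :: s)]/= -natr1 mulrDl mul1r addrC EFinD leeD//.
rewrite lebesgue_measure_itv/= lte_fin; case: ltP => h; last by rewrite lee_fin.
by rewrite -EFinD lee_fin addrAC subrr add0r.
Qed.

(** At stage [n] the set is covered by [2 ^ n] intervals of length [4^-1 ^+ n], of total length at
    most [2^-1 ^+ n]. *)
Lemma leb_cantor_set : leb cantor_set = 0%E.
Proof.
have fin := fine_leb_sub01 measurable_cantor_set.
have sub : cantor_set `<=` I01 by move=> z [_ <-]; exact: cantor01.
have [-> /andP[l0 _]] := fin sub.
have bound n : fine (leb cantor_set) <= 2^-1 ^+ n.
  have [mU lU] := leb_bigU_itv (cantor_ends n) (ltW (q4 n)).
  rewrite -lee_fin -(proj1 (fin sub)).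
  apply: le_trans (le_measure leb _ _ _) (le_trans lU _); rewrite ?inE//.
  - exact: measurable_cantor_set.
  - move=> z [_ <-]; set x := cantorV z.
    rewrite -bigcup_seq; exists (cdigits x n); first exact: cdigits_ends.
    by rewrite /= in_itv/=; exact: cantor_bounds.
  - rewrite lee_fin size_cantor_ends natrX -exprMn.
    by rewrite (_ : 2 * 4^-1 = 2^-1 :> R)//; field.
congr (_%:E); apply/eqP; rewrite eq_le l0 andbT leNgt; apply/negP => h.
have [n _ hn] := near_infty_natSinv_lt (PosNum h).
suff : 2^-1 ^+ n < fine (leb cantor_set) by rewrite ltNge bound.
apply: le_lt_trans (hn n (leqnn n)).
by rewrite exprVn lef_pV2 ?posrE ?exprn_gt0// -natrX ler_nat ltn_expl.
Qed.
End NullEmbedding.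

(** * Quantile functions of subsets of the unit interval *)

Section Quantile.
Context {R : realType}.
Local Notation leb := (@lebesgue_measure R).

Lemma leb_itvoc (x y : R) : x <= y -> leb `]x, y]%classic = (y - x)%:E.
Proof.
rewrite lebesgue_measure_itv/= lte_fin le_eqVlt => /predU1P[->|->].
  by rewrite ltxx subrr.
by rewrite EFinB.
Qed.

Lemma leb_itvoo (x y : R) : x <= y -> leb `]x, y[%classic = (y - x)%:E.
Proof.
rewrite lebesgue_measure_itv/= lte_fin le_eqVlt => /predU1P[->|->].
  by rewrite ltxx subrr.
by rewrite EFinB.
Qed.

Lemma leb_itvco (x y : R) : x <= y -> leb `[x, y[%classic = (y - x)%:E.
Proof.
rewrite lebesgue_measure_itv/= lte_fin le_eqVlt => /predU1P[->|->].
  by rewrite ltxx subrr.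
by rewrite EFinB.
Qed.

Lemma leb_mono (A B : set R) : measurable A -> measurable B -> A `<=` B ->
  (leb A <= leb B)%E.
Proof. by move=> mA mB AB; apply: le_measure; rewrite ?inE. Qed.

Lemma leb_U2 (A B : set R) : measurable A -> measurable B ->
  (leb (A `|` B) <= leb A + leb B)%E.
Proof. by move=> mA mB; apply: measureU2. Qed.

(** Open left rays are stable under intersection, generate the Borel sets, and exhaust the line by
    sets of finite measure, so the uniqueness theorem for measures applies. *)
Lemma eq_measure_rays (m1 m2 : {measure set (measurableTypeR R) -> \bar R}) :
  (forall x : R, m1 `]-oo, x[%classic = m2 `]-oo, x[%classic) ->
  (forall x : R, (m1 `]-oo, x[%classic < +oo)%E) ->
  forall A, measurable A -> m1 A = m2 A.
Proof.
move=> m12 m1fin A mA.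
refine (@measure_unique _ R (measurableTypeR R) (@RGenInftyO.G R)
  (fun n => `]-oo, n%:R[%classic) _ _ _ _ m1 m2 _ _ A mA) => //.
- exact: RGenInftyO.measurableE.
- move=> _ _ [x ->] [y ->]; exists (Num.min x y).
  by apply/seteqP; split=> z /=; rewrite !in_itv/= lt_min; [case=> -> ->|move=> /andP[]].
- by move=> n; exists n%:R.
- apply/seteqP; split=> // x _; exists (Num.bound `|x|) => //=.
  rewrite in_itv/=; apply: (le_lt_trans (ler_norm x)).
  exact: archi_boundP.
- by move=> B [x ->]; exact: m12.
Qed.

Variables (I : set R) (s : R).
Hypotheses (mI : measurable I) (I1 : I `<=` I01).
Let a := fine (leb I).

Let lI : leb I = a%:E. Proof. by have [] := fine_leb_sub01 mI I1. Qed.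

Let ray (x : R) : set R := I `&` `]-oo, x[%classic.

Let mray x : measurable (ray x).
Proof. by apply: measurableI => //; exact: measurable_itv. Qed.

Let F (x : R) : R := s + fine (leb (ray x)).

Let lray x : leb (ray x) = (F x - s)%:E.
Proof.
rewrite /F addrAC subrr add0r.
have ray1 : ray x `<=` I01 by move=> y [/I1].
by have [] := fine_leb_sub01 (mray x) ray1.
Qed.

Let F_nd x y : x <= y -> F x <= F y.
Proof.
move=> xy; rewrite -(lerD2r (- s)) -lee_fin -!lray; apply: leb_mono => //.
move=> z [Iz zx]; split=> //; move: zx; rewrite /= !in_itv/= => zx.
exact: lt_le_trans xy.
Qed.

Let F_lip x y : x <= y -> F y <= F x + (y - x).
Proof.
move=> xy; suff : F y - s <= (F x - s) + (y - x) by lra.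
rewrite -lee_fin (EFinD (F x - s)) -!lray -leb_itvco//.
apply: (@le_trans _ _ (leb (ray x `|` `[x, y[%classic))).
  apply: leb_mono => //; first by apply: measurableU => //; exact: measurable_itv.
  move=> z [Iz]; rewrite /= !in_itv/= => zy.
  have [xz|zx] := leP x z; [right|left].
    by rewrite /= ?in_itv/= ?xz ?zy.
  by split=> //; rewrite /= ?in_itv/=.
by apply: leb_U2 => //; exact: measurable_itv.
Qed.

Let F_cts : continuous F.
Proof.
move=> x; apply/cvgrPdist_lt => e e0; near=> y.
apply: (@le_lt_trans _ _ `|x - y|).
  have [xy|yx] := leP x y.
    rewrite !ler0_norm ?subr_le0 ?F_nd//.
    by have := F_lip xy; lra.
  rewrite !ger0_norm ?subr_ge0 ?F_nd ?(ltW yx)//.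
  by have := F_lip (ltW yx); lra.
by near: y; apply: cvgr_dist_lt => //; exact: cvg_id.
Unshelve. all: by end_near. Qed.

Let F0 : F 0 = s.
Proof.
rewrite /F (_ : ray 0 = set0) ?measure0 ?addr0//.
apply/seteqP; split=> // x [/I1]; rewrite /I01/= !in_itv/= => /andP[x0 _] x0'.
by move: x0; rewrite leNgt x0'.
Qed.

Let F_le x : F x <= s + a.
Proof.
rewrite addrC -lerBlDr -lee_fin -lray -lI; apply: leb_mono => //.
by move=> y [].
Qed.

Let F_ge x : s <= F x.
Proof. by rewrite -subr_ge0 -lee_fin -lray. Qed.

Let F1 : F 1 = s + a.
Proof.
apply/eqP; rewrite eq_le F_le/= addrC -lerBrDr -lee_fin -lray -lI.
apply: (@le_trans _ _ (leb (ray 1 `|` [set 1]))).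
  apply: leb_mono => //; first exact: measurableU.
  move=> x Ix; have := I1 Ix; rewrite /I01/= in_itv/= => /andP[_].
  rewrite le_eqVlt => /predU1P[->|x1]; first by right.
  by left; split=> //; rewrite /= in_itv.
apply: (@le_trans _ _ (leb (ray 1) + leb [set 1%R])%E); first exact: leb_U2.
by rewrite lebesgue_measure_set1 adde0.
Qed.

(* [F] is the distribution function of [leb] on [I], shifted by [s], and [q] its
   quantile function. *)
Lemma quantile : exists F q : R -> R,
  [/\ measurable_fun setT F, measurable_fun setT q,
      forall x, s <= F x <= s + a,
      forall y, s < y <= s + a -> F (q y) = y /\ I01 (q y) &
      forall A, measurable A ->
        leb (q @^-1` A `&` `]s, s + a]%classic) = leb (A `&` I)].
Proof.
have a0 : 0 <= a by rewrite fine_ge0.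
(* Between [s] and [s + a] the intermediate value theorem supplies a preimage under [F]; the
   defaults 0 and 1 outside keep [q] nondecreasing, hence Borel. *)
have ex y : exists x, (y <= s /\ x = 0) \/ (s < y <= s + a /\ F x = y /\ I01 x) \/
    (s + a < y /\ x = 1).
  have [ys|sy] := leP y s; first by exists 0; left.
  have [ysa|say] := leP y (s + a); last by exists 1; right; right.
  have [||x x01 Fx] := @IVT _ F 0 1 y ler01.
  - exact: continuous_subspaceT.
  - rewrite F0 F1 minElt maxElt.
    by case: ltP => h; apply/andP; split; lra.
  - by exists x; right; left.
have [q qP] := boolp.choice ex.
have qmid y : s < y <= s + a -> F (q y) = y /\ I01 (q y).
  move=> /andP[h1 h2]; case: (qP y) => [[]|[[]|[]]]; [lra|by []|lra].
have q01 y : 0 <= q y <= 1.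
  case: (qP y) => [[_ ->]|[[_ [_]]|[_ ->]]]; rewrite ?lexx ?ler01//.
have q_nd y z : y <= z -> q y <= q z.
  move=> yz; have /andP[y0 y1] := q01 y; have /andP[z0 z1] := q01 z.
  case: (qP y) => [[_ ->//]|[[ys [Fy _]]|[ys qy]]].
    case: (qP z) => [[zs qz]|[[zs [Fz _]]|[_ ->//]]]; first by lra.
    rewrite leNgt; apply/negP => h; have := F_nd (ltW h); rewrite Fy Fz => zy.
    have e : y = z by lra.
    by move: h; rewrite e ltxx.
  by case: (qP z) => [[zs qz]|[[zs _]|[zs ->]]]; [lra|lra|rewrite qy].
have mq : measurable_fun setT q by apply: nondecreasing_measurable.
have mF : measurable_fun setT F by apply: nondecreasing_measurable.
exists F, q; split=> //; first by move=> x; rewrite F_ge F_le.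
have mS : measurable (`]s, s + a]%classic : set R) by exact: measurable_itv.
have mq' : @measurable_fun _ _ (measurableTypeR R) (measurableTypeR R) setT q := mq.
have mS' : measurable (`]s, s + a]%classic : set (measurableTypeR R)) := mS.
have mI' : measurable (I : set (measurableTypeR R)) := mI.
pose m1 : {measure set (measurableTypeR R) -> \bar R} :=
  measure_function_pushforward__canonical__measure_function_Measure (mrestr leb mS') mq'.
pose m2 : {measure set (measurableTypeR R) -> \bar R} := mrestr leb mI'.
move=> A mA; suff : m1 A = m2 A by [].
apply: (@eq_measure_rays m1 m2) => // x; last first.
  apply: (@le_lt_trans _ _ (leb `]s, s + a]%classic)).
    apply: leb_mono => //; first apply: measurableI => //.
    rewrite -[X in measurable X]setTI; apply: mq => //; exact: measurable_itv.
  by rewrite leb_itvoc ?ltry// lerDl.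
pose Rx : set R := `]-oo, x[%classic.
pose S : set R := `]s, s + a]%classic.
have mpre : measurable (q @^-1` Rx `&` S).
  apply: measurableI => //.
  rewrite -[X in measurable X]setTI; apply: mq => //; exact: measurable_itv.
suff : leb (q @^-1` Rx `&` S) = leb (ray x) by move=> e; rewrite /ray (setIC I) in e; exact: e.
(* The preimage lies between []s, F x[] and []s, F x]], both of measure [F x - s]. *)
rewrite lray; apply/eqP; rewrite eq_le; apply/andP; split.
  rewrite -leb_itvoc ?F_ge//; apply: leb_mono => //.
  move=> y []; rewrite /= !in_itv/= => qyx yS.
  have [Fq _] := qmid _ yS; have /andP[sy _] := yS.
  have h : s < y <= F x by apply/andP; split; [exact: sy|rewrite -{1}Fq F_nd// ltW].
  exact: h.
rewrite -leb_itvoo ?F_ge//; apply: leb_mono => // y; rewrite /= !in_itv/= => /andP[sy yF].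
have yS : s < y <= s + a by rewrite sy (le_trans (ltW yF)).
split; last exact: yS.
suff h : q y < x by exact: h.
by rewrite ltNge; apply/negP => /F_nd; rewrite (qmid _ yS).1 leNgt yF.
Qed.
End Quantile.

(** * From the two quantile functions to a measure-preserving bijection *)

Section MeasureIso.
Context {R : realType}.
Local Notation leb := (@lebesgue_measure R).
Implicit Types (A B D I P : set R) (f g : R -> R) (x y z : R).

Lemma measurable_preim f A : measurable_fun setT f -> measurable A ->
  measurable (f @^-1` A).
Proof. by move=> mf mA; rewrite -[X in measurable X]setTI; exact: mf. Qed.

Lemma measurable_fix f : measurable_fun setT f -> measurable [set x | f x = x].
Proof.
move=> mf; have -> : [set x | f x = x] = (fun x => f x - x) @^-1` [set 0].
  by apply/seteqP; split=> x /= => [->|/subr0_eq//]; rewrite subrr.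
by apply: measurable_preim => //; exact: measurable_funB.
Qed.

Lemma measurable_fun_piecewise P f g : measurable P -> measurable_fun setT f ->
  measurable_fun setT g -> measurable_fun setT (fun x => if x \in P then f x else g x).
Proof.
move=> mP mf mg _ B mB; rewrite setTI.
have -> : (fun x => if x \in P then f x else g x) @^-1` B =
    (P `&` f @^-1` B) `|` (~` P `&` g @^-1` B).
  apply/seteqP; split=> x /=.
    case: ifPn => [/set_mem Px ?|nPx ?]; first by left.
    by right; split=> // /mem_set; exact/negP.
  by move=> [[Px Bx]|[nPx Bx]]; [rewrite mem_set|rewrite memNset].
by apply: measurableU; apply: measurableI; rewrite ?setTI//;
  first [exact: measurableC | exact: measurable_preim].
Qed.

Lemma leb_U A B : measurable A -> measurable B -> A `&` B = set0 ->
  leb (A `|` B) = (leb A + leb B)%E.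
Proof. by move=> mA mB AB; apply: measureU. Qed.

Lemma leb_null_sub A B : measurable A -> measurable B -> A `<=` B ->
  leb B = 0%E -> leb A = 0%E.
Proof.
by move=> mA mB AB B0; apply/eqP; rewrite eq_le measure_ge0 -B0 leb_mono.
Qed.

Lemma leb_null_U A B : measurable A -> measurable B -> leb A = 0%E ->
  leb B = 0%E -> leb (A `|` B) = 0%E.
Proof.
move=> mA mB A0 B0; apply/eqP; rewrite eq_le measure_ge0 andbT.
by rewrite (le_trans (leb_U2 mA mB))// A0 B0 adde0.
Qed.

Lemma leb_setD_null A B : measurable A -> measurable B -> A `<=` I01 -> B `<=` A ->
  leb A = leb B -> leb (A `\` B) = 0%E.
Proof.
move=> mA mB A1 BA AB; have [eA _] := fine_leb_sub01 mA A1.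
have fin : (leb A < +oo)%E by rewrite eA ltry.
have -> : leb (A `\` B) = (leb A - leb (A `&` B))%E := measureD (mu := leb) mA mB fin.
by rewrite setIidr// -AB eA subee.
Qed.

Lemma leb_setD_nullE A B : measurable A -> measurable B -> leb B = 0%E ->
  leb (A `\` B) = leb A.
Proof.
move=> mA mB B0; apply/eqP; rewrite eq_le; apply/andP; split.
  by apply: (leb_mono (measurableD mA mB) mA); exact: subDsetl.
have mAB := measurableD mA mB.
rewrite -[leRHS]adde0 -B0; apply: le_trans (leb_U2 mAB mB).
apply: (leb_mono mA (measurableU _ _ mAB mB)).
by move=> x Ax; have [Bx|nBx] := pselect (B x); [right|left].
Qed.

(** The quantile function of [I] fills []0, 2^-1]] and that of its complement []2^-1, 1]], hence the
    shift in [quantile]; [g] glues the two distribution functions. [D] keeps the points whose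
    quantile lands in its own set, where [g] inverts [f]. *)
Lemma halving_map I : measurable I -> I `<=` I01 -> leb I = (2^-1)%:E ->
  exists D f g, [/\ measurable D /\ D `<=` I01,
    measurable_fun setT f /\ measurable_fun setT g,
    forall y, D y -> g (f y) = y /\ I01 (f y),
    forall A, measurable A -> leb (D `&` f @^-1` A) = leb (A `&` I01) &
    forall y, D y -> (I (f y) <-> y <= 2^-1)].
Proof.
move=> mI I1 lI; pose J := I01 `\` I.
have mJ : measurable J by apply: measurableD => //; exact: measurable_I01.
have J1 : J `<=` I01 by move=> x [].
have lJ : leb J = (2^-1)%:E.
  rewrite leb_setD01// lI /=; congr (_%:E); lra.
have [F1 [q1 [mF1 mq1 _ Fq1 push1]]] := quantile 0 mI I1.
have [F2 [q2 [mF2 mq2 _ Fq2 push2]]] := quantile 2^-1 mJ J1.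
rewrite lI /= add0r in Fq1 push1.
rewrite lJ /= in Fq2 push2.
have half : 2^-1 + 2^-1 = 1 :> R by lra.
rewrite half in Fq2 push2.
pose S1 : set R := `]0, 2^-1]%classic.
pose S2 : set R := `]2^-1, 1]%classic.
have mS1 : measurable S1 by exact: measurable_itv.
have mS2 : measurable S2 by exact: measurable_itv.
pose P : set R := `]-oo, 2^-1]%classic.
have mP : measurable P by exact: measurable_itv.
pose f y := if y \in P then q1 y else q2 y.
pose g x := if x \in I then F1 x else F2 x.
pose D := (q1 @^-1` I `&` S1) `|` (q2 @^-1` J `&` S2).
have fS1 y : S1 y -> f y = q1 y.
  move=> hy; have y1 : 0 < y <= 2^-1 := hy.
  by rewrite /f mem_set//; case/andP: y1.
have fS2 y : S2 y -> f y = q2 y.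
  move=> hy; have /andP[y1 _] : 2^-1 < y <= 1 := hy.
  by rewrite /f memNset// => h; have : y <= 2^-1 := h; rewrite leNgt y1.
have mq1I A : measurable A -> measurable (q1 @^-1` A `&` S1).
  by move=> mA; apply: measurableI => //; exact: measurable_preim.
have mq2J A : measurable A -> measurable (q2 @^-1` A `&` S2).
  by move=> mA; apply: measurableI => //; exact: measurable_preim.
have S12 A B : (A `&` S1) `&` (B `&` S2) = set0.
  apply/seteqP; split=> // y [[_ h1] [_ h2]].
  have /andP[_ y1] : 0 < y <= 2^-1 := h1.
  have /andP[y2 _] : 2^-1 < y <= 1 := h2.
  by move: y2; rewrite ltNge y1.
exists D, f, g; split.
- split; first by apply: measurableU; [exact: mq1I|exact: mq2J].
  have h01 (y : R) : 0 <= y <= 1 -> I01 y by [].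
  move=> y [[_ h1]|[_ h2]]; apply: h01.
    have /andP[y1 y2] : 0 < y <= 2^-1 := h1.
    by apply/andP; split; lra.
  have /andP[y1 y2] : 2^-1 < y <= 1 := h2.
  by apply/andP; split; lra.
- by split; apply: measurable_fun_piecewise.
- move=> y [[Iy h]|[[Jy nIy] h]].
    rewrite fS1//; have [e e01] := Fq1 y h; split=> //.
    by rewrite /g mem_set.
  by rewrite fS2//; have [e e01] := Fq2 y h; split=> //; rewrite /g memNset.
- move=> A mA.
  have -> : D `&` f @^-1` A = (q1 @^-1` (A `&` I) `&` S1) `|` (q2 @^-1` (A `&` J) `&` S2).
    apply/seteqP; split=> y.
      move=> [[[h1 h2]|[h1 h2]] Ay].
        by left; split=> //; split=> //; have : A (f y) := Ay; rewrite (fS1 y h2).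
      by right; split=> //; split=> //; have : A (f y) := Ay; rewrite (fS2 y h2).
    move=> [[[Ay Iy] h]|[[Ay Jy] h]]; split; [by left| |by right|].
      by suff : A (f y) by []; rewrite (fS1 y h).
    by suff : A (f y) by []; rewrite (fS2 y h).
  rewrite leb_U//; [|by apply: mq1I; exact: measurableI|by apply: mq2J; exact: measurableI].
  rewrite push1; last exact: measurableI.
  rewrite push2; last exact: measurableI.
  have mAI : measurable (A `&` I) by exact: measurableI.
  have mAJ : measurable (A `&` J) by exact: measurableI.
  have AIJ : (A `&` I) `&` (A `&` J) = set0 by rewrite setIACA setDIK setI0.
  have -> : A `&` I `&` I = A `&` I by rewrite -setIA setIid.
  have -> : A `&` J `&` J = A `&` J by rewrite -setIA setIid.
  etransitivity; first exact: (esym (leb_U mAI mAJ AIJ)).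
  by rewrite -setIUr setDUK.
- move=> y [[Iy h]|[[Jy nIy] h]].
    by have /andP[y1 y2] : 0 < y <= 2^-1 := h; rewrite fS1.
  have /andP[y1 _] : 2^-1 < y <= 1 := h.
  by rewrite fS2//; split=> // y2; move: y1; rewrite ltNge y2.
Qed.

(** With a Borel left inverse [g], the image is the set of [z] with [g z] in [A] and
    [f (g z) = z]. *)
Lemma measurable_image_inj f g D A : measurable_fun setT f -> measurable_fun setT g ->
  measurable D -> (forall x, D x -> g (f x) = x) -> measurable A -> A `<=` D ->
  measurable (f @` A).
Proof.
move=> mf mg mD gf mA AD.
have -> : f @` A = g @^-1` A `&` [set z | f (g z) = z].
  apply/seteqP; split=> z; first by move=> [x Ax <-]; rewrite /= gf//; exact: AD.
  by move=> [Agz e]; exists (g z).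
apply: measurableI; first exact: measurable_preim.
by apply: measurable_fix; exact: measurableT_comp.
Qed.

Definition cc x : R := cantor (cantor x).
Definition ccV x : R := cantorV (cantorV x).

Section Schroeder.
Variables N0 N1 : set R.
Hypotheses (mN0 : measurable N0) (mN1 : measurable N1).
Hypotheses (N01 : N0 `<=` I01) (N11 : N1 `<=` I01).
Hypotheses (CN0 : cantor_set `<=` N0) (CN1 : cantor_set `<=` N1).

(* Cantor-Bernstein for the embedding [cantor] used in both directions. *)
Fixpoint csb_layer n : set R :=
  if n is m.+1 then cc @` csb_layer m else N0 `\` cantor @` N1.

Definition csb_dom : set R := \bigcup_n csb_layer n.

Let layerN0 n : csb_layer n `<=` N0.
Proof.
elim: n => [x []//|n IH] _ [x /IH/N01 x01 <-].
by apply: CN0; apply: cantor_in; exact: cantor01.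
Qed.

Let mlayer n : measurable (csb_layer n).
Proof.
elim: n => [|n IH].
  apply: measurableD => //; apply: (@measurable_image_inj cantor cantorV (@I01 R)) => //.
  - exact: measurable_cantor.
  - exact: measurable_cantorV.
  - exact: measurable_I01.
  - exact: cantorK.
apply: (@measurable_image_inj cc ccV (@I01 R)) => //.
- exact: measurableT_comp measurable_cantor measurable_cantor.
- exact: measurableT_comp measurable_cantorV measurable_cantorV.
- exact: measurable_I01.
- by move=> x x01; rewrite /cc /ccV cantorK ?cantorK//; exact: cantor01.
- by move=> x /layerN0/N01.
Qed.

Lemma measurable_csb_dom : measurable csb_dom.
Proof. by apply: bigcupT_measurable. Qed.

Let domN0 : csb_dom `<=` N0. Proof. by move=> x [n _ /layerN0]. Qed.

Let dom_cc x : csb_dom x -> csb_dom (cc x).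
Proof. by move=> [n _ hx]; exists n.+1 => //; exists x. Qed.

Let notin_dom x : N0 x -> ~ csb_dom x -> N1 (cantorV x) /\ cantor (cantorV x) = x.
Proof.
move=> N0x nx; have [z N1z <-] : (cantor @` N1) x.
  by apply: contrapT => h; apply: nx; exists 0%N.
by rewrite cantorK//; exact: N11.
Qed.

Let cantor_dom x : csb_dom (cantor x) -> I01 x ->  N1 x ->
  csb_dom (cantorV x) /\ cantor (cantorV x) = x.
Proof.
move=> [[|n] _ /=]; first by move=> [_ h] _ N1x; exfalso; apply: h; exists x.
move=> [w hw e] x01 _; have w01 := N01 (layerN0 hw).
have <- : cantor w = x.
  by rewrite -(cantorK x01) -e /cc cantorK//; exact: cantor01.
by rewrite cantorK//; split=> //; exists n.
Qed.

Definition csb x : R := if x \in csb_dom then cantor x else cantorV x.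
(** A point [z] of [N1] comes from the [cantor] branch of [csb] exactly when [cantor z] lies in
    [csb_dom]: such a value avoids layer 0, so it is [cc w] with [w] one layer down, and then
    [z = cantor w]. *)
Definition csbV z : R := if z \in cantor @^-1` csb_dom then cantorV z else cantor z.

Lemma csbK x : N0 x -> N1 (csb x) /\ csbV (csb x) = x.
Proof.
move=> N0x; rewrite /csb; case: ifPn => [/set_mem dx|/negP ndx].
  have x01 := N01 N0x; split; first by apply: CN1; exact: cantor_in.
  by rewrite /csbV mem_set ?cantorK//; exact: dom_cc.
have [N1x e] : N1 (cantorV x) /\ cantor (cantorV x) = x.
  by apply: notin_dom => // h; apply: ndx; exact: mem_set.
split=> //; rewrite /csbV memNset//= e => h; apply: ndx; exact: mem_set.
Qed.

Lemma csbVK z : N1 z -> N0 (csbV z) /\ csb (csbV z) = z.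
Proof.
move=> N1z; have z01 := N11 N1z; rewrite /csbV; case: ifPn => [/set_mem dz|/negP ndz].
  have [d e] := cantor_dom dz z01 N1z.
  by split; [exact: domN0|rewrite /csb mem_set].
split; first by apply: CN0; exact: cantor_in.
rewrite /csb memNset ?cantorK// => h; apply: ndz; exact: mem_set.
Qed.

Lemma measurable_csb : measurable_fun setT csb.
Proof.
apply: measurable_fun_piecewise; first exact: measurable_csb_dom.
- exact: measurable_cantor.
- exact: measurable_cantorV.
Qed.

Lemma measurable_csbV : measurable_fun setT csbV.
Proof.
apply: measurable_fun_piecewise.
- exact: measurable_preim measurable_cantor measurable_csb_dom.
- exact: measurable_cantorV.
- exact: measurable_cantor.
Qed.
End Schroeder.

(** Only null sets separate [f] from a bijection: [f] is kept on a set [D'] of full measure, and the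
    leftovers [N0] and [N1] are matched by [csb]. *)
Lemma mp_bijection_extend D f g : measurable D -> D `<=` I01 ->
  measurable_fun setT f -> measurable_fun setT g ->
  (forall y, D y -> g (f y) = y /\ I01 (f y)) ->
  (forall A, measurable A -> leb (D `&` f @^-1` A) = leb (A `&` I01)) ->
  exists s N, [/\ mp_bijection s, measurable N, leb N = 0%E &
    forall y, I01 y -> ~ N y -> D y /\ s y = f y].
Proof.
move=> mD D1 mf mg gf push; have mI := @measurable_I01 R.
have mC := @measurable_cantor_set R; have C0 := @leb_cantor_set R.
have C1 : cantor_set `<=` @I01 R by move=> z [_ <-]; exact: cantor01.
have mfC : measurable (f @^-1` cantor_set) by exact: measurable_preim.
(* Removing the null set [cantor_set] and its preimage places [cantor_set] inside both leftovers, as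
   the Cantor-Bernstein argument requires. *)
pose D' := (D `\` cantor_set) `\` (D `&` f @^-1` cantor_set).
have mDf : measurable (D `&` f @^-1` cantor_set) by exact: measurableI.
have mD' : measurable D' by do 2 apply: measurableD => //.
have D'D : D' `<=` D by move=> x [[]].
have lD : leb D = 1%E.
  by have := push _ measurableT; rewrite preimage_setT setIT setTI leb_I01.
have lD' : leb D' = 1%E.
  rewrite leb_setD_nullE//; [by rewrite leb_setD_nullE|exact: measurableD|].
  by rewrite push// setIidl.
pose E' := f @` D'.
have mE' : measurable E'.
  by apply: (@measurable_image_inj f g D) => // x Dx; have [] := gf x Dx.
have E'1 : E' `<=` I01 by move=> _ [x /D'D/gf[_ ?] <-].
have lE' : leb E' = 1%E.
  apply/eqP; rewrite eq_le; apply/andP; split.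
    by rewrite -(@leb_I01 R) leb_mono.
  rewrite -(setIidl E'1) -push// -lD' leb_mono//.
    by apply: measurableI => //; exact: measurable_preim.
  by move=> x D'x; split; [exact: D'D|exists x].
pose N0 := @I01 R `\` D'; pose N1 := @I01 R `\` E'.
have mN0 : measurable N0 by exact: measurableD.
have mN1 : measurable N1 by exact: measurableD.
have N01 : N0 `<=` I01 by move=> x [].
have N11 : N1 `<=` I01 by move=> x [].
have CN0 : cantor_set `<=` N0 by move=> x Cx; split; [exact: C1|move=> [[_ ]]].
have CN1 : cantor_set `<=` N1.
  move=> x Cx; split; first exact: C1.
  by move=> [y [[Dy _] h] e]; apply: h; split=> //=; rewrite e.
have lN0 : leb N0 = 0%E.
  apply: leb_setD_null => //; last by rewrite leb_I01 lD'.
  exact: subset_trans D1.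
pose s y := if y \in D' then f y else csb N0 N1 y.
pose r z := if z \in E' then g z else csbV N0 N1 z.
have sD y : D' y -> s y = f y by move=> h; rewrite /s mem_set.
have sN y : N0 y -> s y = csb N0 N1 y by move=> [_ h]; rewrite /s memNset.
have rE z : E' z -> r z = g z by move=> h; rewrite /r mem_set.
have rN z : N1 z -> r z = csbV N0 N1 z by move=> [_ h]; rewrite /r memNset.
have caseD y : I01 y -> D' y \/ N0 y.
  by move=> y1; have [|] := pselect (D' y); [left|right].
have caseE z : I01 z -> E' z \/ N1 z.
  by move=> y1; have [|] := pselect (E' z); [left|right].
have sK y : I01 y -> I01 (s y) /\ r (s y) = y.
  move=> /caseD[h|h].
    have [e1 e2] := gf y (D'D _ h).
    by rewrite sD//; split=> //; rewrite rE//; exists y.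
  have [h1 h2] := csbK N01 N11 CN1 h.
  by rewrite sN// rN//; split=> //; exact: N11.
have rK z : I01 z -> I01 (r z) /\ s (r z) = z.
  move=> /caseE[|h].
    move=> [y D'y e]; have [e1 e2] := gf y (D'D _ D'y).
    rewrite rE; last by exists y.
    by rewrite -e e1; split; [exact: D1 (D'D _ D'y)|exact: sD].
  have [h1 h2] := csbVK N01 N11 CN0 h.
  by rewrite rN// sN//; split=> //; exact: N01.
have ms : measurable_fun setT s.
  apply: measurable_fun_piecewise => //; exact: measurable_csb.
have mr : measurable_fun setT r.
  apply: measurable_fun_piecewise => //; exact: measurable_csbV.
exists s, N0; split=> //; last first.
  by move=> y /caseD[h _|//]; split; [exact: D'D|exact: sD].
split.
- split.
  + by move=> y /sK[].
  + by move=> y z /set_mem/sK[_ ey] /set_mem/sK[_ ez] e; rewrite -ey -ez e.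
  + by move=> z /rK[h1 h2]; exists (r z).
- exact: measurable_funTS.
- move=> A mA A1; apply: (@measurable_image_inj s r (@I01 R)) => // y /sK[].
  by [].
- move=> A mA A1.
  have -> : I01 `&` s @^-1` A = (D' `&` f @^-1` A) `|` (N0 `&` s @^-1` A).
    apply/seteqP; split=> y.
      by move=> [/caseD[h|h] sy]; [left; split=> //; move: sy; rewrite /= sD|right].
    move=> [[h sy]|[h sy]]; split=> //; [exact: D1 (D'D _ h)|by rewrite /= sD|exact: N01].
  have msA := measurable_preim ms mA; have mfA := measurable_preim mf mA.
  have l0 : leb (N0 `&` s @^-1` A) = 0%E.
    by apply: (leb_null_sub _ mN0) => //; exact: measurableI.
  rewrite leb_U; [|exact: measurableI|exact: measurableI|]; last first.
    by apply/seteqP; split=> // y [[h _] [[_]]].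
  rewrite l0 adde0.
  (* [D'] differs from [D] by a null set, so the push-forward property on [D] carries over. *)
  have -> : D' `&` f @^-1` A = (D `&` f @^-1` A) `\` ((cantor_set `|` D `&` f @^-1` cantor_set)).
    apply/seteqP; split=> y.
      move=> [[[Dy Cy] h] fy]; split=> //; by case.
    by move=> [[Dy fy] h]; split=> //; split=> [|h']; [split=> // h'|]; apply: h; [left|right].
  rewrite leb_setD_nullE; [|exact: measurableI|exact: measurableU|]; last first.
    by apply: leb_null_U => //; rewrite push// setIidl.
  by rewrite push// setIidl.
Qed.

Lemma halving_mp_bijection I : measurable I -> I `<=` I01 -> leb I = (2^-1)%:E ->
  exists s N, [/\ mp_bijection s, measurable N, leb N = 0%E &
    forall y, I01 y -> ~ N y -> (I (s y) <-> y <= 2^-1)].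
Proof.
move=> mI I1 lI; have [D [f [g [[mD D1] [mf mg] gf push half]]]] := halving_map mI I1 lI.
have [s [N [mps mN N0 sN]]] := mp_bijection_extend mD D1 mf mg gf push.
by exists s, N; split=> // y y1 Ny; have [Dy ->] := sN y y1 Ny; exact: half.
Qed.
End MeasureIso.

(** * Relabelling *)

Section Relabelling.
Context {R : realType}.
Local Notation leb := (@lebesgue_measure R).
Local Notation leb2 := (leb \x leb)%E.

Lemma mp_bijection_in (s : R -> R) x : mp_bijection s -> I01 x -> I01 (s x).
Proof. by move=> [[fs _ _] _ _ _]; exact: fs. Qed.

Lemma mp_bijection_id : @mp_bijection R id.
Proof.
split.
- by split=> [x|x y _ _|x x1] //; exists x.
- exact: measurable_id.
- by move=> A mA _; rewrite image_id.
- by move=> A mA A1; rewrite preimage_id setIidr.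
Qed.

(** The section of the preimage at [x] is the preimage of the section at [s x], hence null unless
    [s x] lies in the null set [Z] of bad points, whose own preimage is null. *)
Lemma ae_relabel (s : R -> R) (P : R * R -> Prop) : mp_bijection s ->
  {ae leb2, forall z, P z} ->
  {ae leb2, forall z, sq01 z -> P (s z.1, s z.2)}.
Proof.
move=> mps [N [mN N0 PN]]; have s01 := fun x => @mp_bijection_in s x mps.
case: mps => _ ms _ pres; have m1 := @measurable_I01 R.
(* Measurability of [s] is known on [I01] only; the extension by a constant makes [q] measurable on
   the whole plane. *)
pose s' := s \_ (@I01 R).
have s'E x : I01 x -> s' x = s x by move=> x1; rewrite /s' patchE mem_set.
have ms' : measurable_fun setT s' by apply/(measurable_restrictT _ m1).
pose q (z : R * R) := (s' z.1, s' z.2).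
have mq : measurable_fun setT q.
  apply: measurable_fun_pair.
    by apply: measurableT_comp; [exact: ms'|exact: measurable_fst].
  by apply: measurableT_comp; [exact: ms'|exact: measurable_snd].
pose N' := sq01 `&` q @^-1` N.
have mN' : measurable N'.
  apply: measurableI; first exact: measurable_sq01.
  by rewrite -[X in measurable X]setTI; exact: mq.
exists N'; split=> //; last first.
  move=> [x y] /= /not_implyP[[/= x1 y1] nP]; split=> //.
  have : N (s x, s y) by exact: PN.
  by rewrite -(s'E x x1) -(s'E y y1).
apply/(product_measure_eq0 leb leb mN').
move: (N0) => /(product_measure_eq0 leb leb mN)[Z [mZ Z0 NZ]].
have presI A : measurable A -> leb A = 0%E -> leb (I01 `&` s' @^-1` A) = 0%E.
  move=> mA A0; have -> : I01 `&` s' @^-1` A = I01 `&` s @^-1` (A `&` I01).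
    apply/seteqP; split=> x [x1].
      rewrite /= s'E// => Asx; split; first exact: x1.
      by split; [exact: Asx|exact: s01].
    by move=> [Asx _]; split; rewrite /= ?s'E.
  have mAI : measurable (A `&` I01) by exact: measurableI.
  have AI1 : A `&` I01 `<=` I01 by move=> x [].
  rewrite (pres _ mAI AI1).
  by apply: (leb_null_sub mAI mA _ A0) => x [].
exists (I01 `&` s' @^-1` Z); split.
- by apply: measurableI => //; exact: measurable_preim.
- exact: presI.
move=> x /= nx; apply: contrapT => nZ; apply: nx.
have [x1|nx1] := pselect (I01 x); last first.
  have E0 : xsection N' x = set0.
    by apply/seteqP; split=> // y; rewrite /xsection/= inE => -[[]].
  by rewrite E0 measure0.
have -> : xsection N' x = I01 `&` s' @^-1` (xsection N (s' x)).
  apply/seteqP; split=> y; rewrite /xsection/= !inE.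
    by move=> [[_ y1] Nq].
  by move=> [y1 Nq].
apply: presI; first exact: measurable_xsection.
by apply: contrapT => h; apply: nZ; split=> //; apply: NZ.
Qed.

Lemma ae_fst_snd (N : set R) : measurable N -> leb N = 0%E ->
  {ae leb2, forall z, ~ N z.1 /\ ~ N z.2}.
Proof.
move=> mN N0; exists ((N `*` setT) `|` (setT `*` N)); split.
- by apply: measurableU; exact: measurableX.
- have h1 : leb2 (N `*` setT) = 0%E by rewrite leb2E// N0 mul0e.
  have h2 : leb2 (setT `*` N) = 0%E by rewrite leb2E// N0 mule0.
  have m1 : measurable (N `*` [set: R]) by exact: measurableX.
  have m2 : measurable ([set: R] `*` N) by exact: measurableX.
  apply/eqP; rewrite eq_le measure_ge0 andbT.
  have := @measureU2 _ _ _ leb2 _ _ m1 m2.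
  move=> /le_trans; apply.
  suff -> : (leb2 (N `*` setT) + leb2 (setT `*` N) = 0)%E by [].
  by rewrite h1 h2 adde0.
- move=> [x y] /= h; have [Nx|nNx] := pselect (N x); first by left.
  by right; split=> //; apply: contrapT => nNy; apply: h.
Qed.

Lemma bipodal_relabel (s : R -> R) t a b c (I : set R) z : mp_bijection s -> sq01 z ->
  relabel s (bipodal t a b c I) z = bipodal t a b c (I01 `&` s @^-1` I) z.
Proof.
move=> mps zsq; case: z zsq => x y [/= x1 y1]; rewrite /relabel /=.
have sx1 := mp_bijection_in mps x1; have sy1 := mp_bijection_in mps y1.
rewrite !bipodalE//.
have E (u : R) : I01 u -> \1_(I01 `&` s @^-1` I) u = \1_I (s u) :> R.
  move=> u1; rewrite !indicE in_setI (mem_set u1) /=.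
  have -> : (u \in s @^-1` I) = (s u \in I) by apply/idP/idP; rewrite !inE.
  by [].
by rewrite !E.
Qed.

(** The competitor for the optimum. Its kernel is [t - d * f x * f y] with [f] equal to 1 and -1 on
    the two halves, so its eigenvalues are [t] and [- d], and the triangle density is the sum of
    their cubes. *)
Lemma exact_bipodal_graphon (t d : R) : 0 < d -> d <= t -> t <= 2^-1 ->
  let h := @bipodal R t (- d) d (- d) `[0, 2^-1]%classic in
  [/\ graphon h, edge_density h = t, triangle_density h = t ^+ 3 - d ^+ 3 &
      Igraphon h = (Ifun (t + d) + Ifun (t - d)) / 2].
Proof.
move=> d0 dt t2 h; pose I : set R := `[0, 2^-1]%classic.
have mI : measurable I by exact: measurable_itv.
have I1 : I `<=` I01.
  move=> x; rewrite /I /I01 /= !in_itv/= => /andP[-> h2]/=; lra.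
have lI : leb I = (2^-1)%:E.
  by rewrite /I lebesgue_measure_itv/= lte_fin invr_gt0 ltr0n/= sube0.
have hE x y : I01 x -> I01 y -> h (x, y) = (t - d) * (\1_I x * \1_I y) +
   (t + d) * (\1_I x * (1 - \1_I y) + (1 - \1_I x) * \1_I y) +
   (t - d) * ((1 - \1_I x) * (1 - \1_I y)).
  by move=> x1 y1; rewrite /h bipodalE.
have gh : graphon h.
  split.
  - have mJ : measurable (@I01 R `\` I) by apply: measurableD => //; exact: measurable_I01.
    apply: measurable_funD; first apply: measurable_funD; first apply: measurable_funD => //.
    + apply: measurable_funM => //; apply: measurable_indic; exact: measurableX.
    + apply: measurable_funM => //; apply: measurable_indic.
      by apply: measurableU; exact: measurableX.
    + apply: measurable_funM => //; apply: measurable_indic; exact: measurableX.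
  - move=> [x y] [/= x1 y1]; rewrite hE// !indicE.
    by case: (x \in I); case: (y \in I); rewrite /=; apply/andP; split; lra.
  - by move=> x y x1 y1; rewrite !hE//; ring.
have hb : {ae leb2, forall z, sq01 z -> h z = bipodal t (- d) d (- d) I z}.
  by exists set0; split => // z /= nz; exfalso; apply: nz.
rewrite (edge_density_bipodal gh mI I1 hb) (triangle_density_bipodal gh mI I1 hb)
  (Igraphon_bipodal gh mI I1 hb) lI /= /bavg.
by split=> //; field.
Qed.
End Relabelling.

(** * Exact form of the maximisers for small deficits *)

Section Main.
Context {R : realType}.
Local Notation leb := (@lebesgue_measure R).
Local Notation leb2 := (leb \x leb)%E.

Lemma cube_root_cubeK (e : R) : 0 <= e -> (e `^ (1 / 3)) ^+ 3 = e.
Proof.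
move=> e0; rewrite -powR_mulrn ?powR_ge0// -powRrM div1r mulVf ?powRr1//.
Qed.

(** Matching [d ^+ 3] with the deficit [t ^+ 3 * e] forces [d = t * u], where [u] is the cube root
    of [e]. The bound on [e] says [u < t / 300], which with [u < 1] gives the smallness of [d] asked
    by [bipodal_optimum]. *)
Lemma maximiser_exact (t e : R) h : 0 < t -> t <= 2^-1 -> 0 < e ->
  e < (t / 300) ^+ 3 -> is_maximiser t (t ^+ 3 - t ^+ 3 * e) h ->
  has_bipodal_form t h ->
  exists2 s, mp_bijection s & {ae leb2, forall z, sq01 z ->
    relabel s h z = t + e `^ (1 / 3) * gstar t z}.
Proof.
move=> t0 t2 e0 esmall [gh eh th hmax] [a [b [c [I [[a1 b1 c1] mI I1 [s0 mps0 hs0]]]]]].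
pose u := e `^ (1 / 3); pose d := t * u.
have u0 : 0 < u by exact: powR_gt0.
have u3 : u ^+ 3 = e by rewrite cube_root_cubeK// ltW.
have ut : u < t / 300.
  rewrite -u3 in esmall; rewrite ltNge; apply/negP => h1.
  move: esmall; rewrite ltNge => /negP; apply.
  by rewrite lerXn2r// nnegrE; lra.
have d0 : 0 < d by rewrite mulr_gt0.
have d3 : d ^+ 3 = t ^+ 3 * e by rewrite exprMn u3.
have d2 : d ^+ 2 <= t ^+ 3 / 300.
  have -> : t ^+ 3 / 300 = t ^+ 2 * (t / 300) by ring.
  rewrite exprMn ler_pM2l ?exprn_gt0//; nra.
have dt : d <= t by rewrite /d; nra.
(* The bipodal form is given up to a relabelling [s0]; passing to the preimage of [I] makes [h]
   itself bipodal almost everywhere. *)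
pose I' := @I01 R `&` s0 @^-1` I.
have mI' : measurable I' by case: (mps0) => _ ms _ _; exact: ms measurable_I01 _ mI.
have I'1 : I' `<=` I01 by exact: subIsetl.
have hb : {ae leb2, forall z, sq01 z -> h z = bipodal t a b c I' z}.
  by apply: ae_imp hs0 => z hz zsq; rewrite hz// bipodal_relabel.
have [gc ec tc Ic] := exact_bipodal_graphon d0 dt t2.
have ent := hmax _ gc ec ltac:(by rewrite tc d3).
have [lI' al01] := fine_leb_sub01 mI' I'1.
move: ent; rewrite Ic lerN2 (Igraphon_bipodal gh mI' I'1 hb) => ent.
move: eh; rewrite (edge_density_bipodal gh mI' I'1 hb) => eh.
move: th; rewrite (triangle_density_bipodal gh mI' I'1 hb) -d3 => th.
have [||||al aE bE cE] := @bipodal_optimum R t d _ a b c t0 t2 d0 d2 al01 _ _ _ _ th ent; try lra.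
  by move: eh; rewrite /bavg /=; set al := fine _ => eh; lra.
have lI2 : leb I' = (2^-1)%:E by rewrite lI' al.
have [s [N [mps mN N0 sN]]] := halving_mp_bijection mI' I'1 lI2.
exists s => //.
have h1 := ae_relabel mps hb.
apply: ae_imp (ae_and h1 (ae_fst_snd mN N0)) => -[x y] /= [hxy [Nx Ny]] [/= x1 y1].
have sx1 := mp_bijection_in mps x1; have sy1 := mp_bijection_in mps y1.
rewrite /relabel hxy//= bipodalE// aE bE cE /gstar /=.
have ind w : I01 w -> ~ N w -> \1_I' (s w) = (w <= 2^-1)%R%:R :> R.
  move=> w1 Nw; rewrite indicE.
  have -> : (s w \in I') = (w <= 2^-1)%R; last by [].
  by apply/idP/idP => [/set_mem/(sN w w1 Nw)//|/(sN w w1 Nw)]; exact: mem_set.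
rewrite !ind// !(ltNge 2^-1) -/u /d.
by case: (x <= 2^-1); case: (y <= 2^-1); rewrite /=; ring.
Qed.
End Main.

Unset Implicit Arguments.
Set Strict Implicit.
Set Printing Implicit Defensive.

Theorem proposition2 (R : realType) (t1 : R) (ht1 : 0 < t1 <= 2^-1)
  (hA2 : assumption2 t1)
  (h : R -> R * R -> R)
  (hmax : \forall eps \near (0 : R)^'+,
            is_maximiser t1 (t1 ^+ 3 - t1 ^+ 3 * eps) (h eps)) :
  exists s : R -> R -> R,
    (forall eps, mp_bijection (s eps)) /\
    unif_littleo
      (fun eps z => relabel (s eps) (h eps) z
                    - (t1 + eps `^ (1 / 3) * gstar t1 z))
      (fun eps => eps `^ (2 / 3)).
Proof.
case/andP: ht1 => t0 t2.
pose exact_at eps s := {ae (lebesgue_measure \x lebesgue_measure)%E, forall z, sq01 z ->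
    relabel s (h eps) z = t1 + eps `^ (1 / 3) * gstar t1 z}.
(* A bijection is demanded for every [eps]; where no relabelling gives the exact formula, the
   identity is the default. *)
have choose eps : exists s, mp_bijection s /\
    ((exists2 s', mp_bijection s' & exact_at eps s') -> exact_at eps s).
  have [[s mps es]|nex] := pselect (exists2 s', mp_bijection s' & exact_at eps s').
    by exists s.
  by exists id; split; [exact: mp_bijection_id|move=> /nex].
have [s sP] := boolp.choice choose.
exists s; split=> [eps|delta delta0]; first by have [] := sP eps.
have t30 : 0 < t1 ^+ 3 by rewrite exprn_gt0.
(* Assumption 2 is used on the negative side, at the perturbation [- (t1 ^+ 3 * eps)]. *)
have A2 : \forall eps \near (0 : R)^'+, has_bipodal_form t1 (h eps).
  move: hA2; rewrite /assumption2 /dnbhs /within/= => /nbhs_ballP[r /= r0 rA2].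
  have rt : 0 < r / t1 ^+ 3 by rewrite divr_gt0.
  near=> eps.
  have e0 : 0 < eps by [].
  have ert : t1 ^+ 3 * eps < r.
    by rewrite mulrC -ltr_pdivlMr//; near: eps; exact: nbhs_right_lt.
  have te0 : 0 < t1 ^+ 3 * eps by rewrite mulr_gt0.
  have [||_ form] := rA2 (- (t1 ^+ 3 * eps)).
  - by rewrite /ball/= sub0r opprK ger0_norm// ltW.
  - by rewrite oppr_eq0 gt_eqF.
  - by apply: form; near: eps; exact: hmax.
near=> eps.
have e0 : 0 < eps by [].
have [_ /(_ _)] := sP eps.
have esmall : eps < (t1 / 300) ^+ 3.
  by near: eps; apply: nbhs_right_lt; rewrite exprn_gt0// divr_gt0.
have form : has_bipodal_form t1 (h eps) by near: eps; exact: A2.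
have max : is_maximiser t1 (t1 ^+ 3 - t1 ^+ 3 * eps) (h eps) by near: eps; exact: hmax.
move=> /(_ (maximiser_exact t0 t2 e0 esmall max form)); apply: ae_imp => z ez zsq.
(* Where the exact formula holds the remainder is 0, hence below any positive [delta] times the
   rate. *)
by rewrite ez// subrr normr0 mulr_ge0// ltW.
Unshelve. all: by end_near. Qed.
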